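(* Suppose $\mathbb K\neq\mathbb R$. Let $d$ be a metric on $\mathfrak H_{\mathbb K}$, and denote again by $d$ its extension to $\partial\mathbf{H}^n_{\mathbb K}=\mathfrak H_{\mathbb K}\cup\{\infty\}$. Suppose that all of the following hold: (Sim) $\mathrm{Sim}_{d_{\mathfrak H}}\subseteq\mathrm{Sim}_d$; (Top) every sequence $(p_\nu)_{\nu\in\mathbb N}$ in $\partial\mathbf{H}^n_{\mathbb K}$ which converges in the $d_{\mathfrak H}$-topology of $\partial\mathbf{H}^n_{\mathbb K}$ converges in the $d$-topology of $\partial\mathbf{H}^n_{\mathbb K}$; (Inv) the inversion $I$ belongs to $\mathcal M_d$. Then there exist constants $\beta>0$ and $\alpha\in(0,1]$ such that $d=\beta\cdot d_{\mathfrak H}^{\alpha}$.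
   Context: $\mathbb K$ is one of $\mathbb R,\mathbb C,\mathbb H,\mathbb O$ (reals, complex numbers, quaternions, octonions), with conjugation $z\mapsto\overline z$ (the identity if $\mathbb K=\mathbb R$) and norm $|z|$; $n\ge 2$ is an integer, and $n=2$ if $\mathbb K=\mathbb O$. Put $\Im(\mathbb K)=\{z\in\mathbb K: z=-\overline z\}$, $\operatorname{Im}z=(z-\overline z)/2$, and $\|\zeta\|^2=\sum_i|\zeta_i|^2$ for $\zeta\in\mathbb K^{n-1}$. The $\mathbb K$-Heisenberg group $\mathfrak H_{\mathbb K}$ is the set $\mathbb K^{n-1}\times\Im(\mathbb K)$ with the multiplication $(\zeta,v)*(\zeta',v')=(\zeta+\zeta',\,v+v'+2\omega(\zeta,\zeta'))$, where $\omega(\zeta,\zeta')=\operatorname{Im}\big(\sum_i\overline{\zeta'_i}\zeta_i\big)$; thus $(\zeta,v)^{-1}=(-\zeta,-v)$, and the origin is $o=(0,0)$. The boundary of $\mathbb K$-hyperbolic space is identified with $\partial\mathbf{H}^n_{\mathbb K}=\mathfrak H_{\mathbb K}\cup\{\infty\}$. The Korányi gauge is $|(\zeta,v)|_{\mathbb K}=(\|\zeta\|^4+|v|^2)^{1/4}$ and the Korányi metric is $d_{\mathfrak H}(p,q)=|q^{-1}*p|_{\mathbb K}$ on $\mathfrak H_{\mathbb K}$. Any metric $d$ on $S=\mathfrak H_{\mathbb K}$ (in particular $d_{\mathfrak H}$) is extended to $\overline S=S\cup\{\infty\}$ by $d(p,\infty)=+\infty$ for $p\in S$ and $d(\infty,\infty)=0$.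 The $d$-topology on $\overline S$ is the one extending the metric topology of $S$ for which the sets $\{q\in S:d(o,q)>R\}\cup\{\infty\}$, $R>0$, are basic neighbourhoods of $\infty$. For pairwise distinct $p_1,\dots,p_4\in\overline S$ the metric cross-ratio is $|\mathbb X^d|(p_1,p_2,p_3,p_4)=\frac{d(p_4,p_2)}{d(p_4,p_1)}\cdot\frac{d(p_3,p_1)}{d(p_3,p_2)}$, where, if one of the points is $\infty$, the two factors containing $\infty$ are cancelled. The Möbius group $\mathcal M_d$ is the group of homeomorphisms of $\overline S$ (in the $d$-topology) which leave $|\mathbb X^d|$ invariant on all quadruples of pairwise distinct points. The similarity group $\mathrm{Sim}_d$ is the set of $\phi\in\mathcal M_d$ for which there is a constant $K(\phi)>0$ with $d(\phi(p),\phi(q))=K(\phi)\,d(p,q)$ for all $p,q\in S$. The inversion $I:\partial\mathbf{H}^n_{\mathbb K}\to\partial\mathbf{H}^n_{\mathbb K}$ is given by $I(\zeta,v)=\big(\zeta(-\|\zeta\|^2+v)^{-1},\ \overline v\,|-\|\zeta\|^2+v|^{-2}\big)$ for $(\zeta,v)\neq o$ in $\mathfrak H_{\mathbb K}$ (each coordinate of $\zeta$ multiplied on the right), $I(o)=\infty$, $I(\infty)=o$. *)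

(* Defs.v *)
(* MathComp + MathComp-Analysis *)
From HB Require Import structures.
From mathcomp Require Import all_boot all_order all_algebra.
From mathcomp Require Import complex.
From mathcomp Require Import all_classical all_reals all_analysis.

Set Implicit Arguments.
Unset Strict Implicit.
Unset Printing Implicit Defensive.

Import Order.TTheory GRing.Theory Num.Theory.

Local Open Scope classical_set_scope.
Local Open Scope ring_scope.

(* Real vector spaces with a (possibly nonassociative) product and a
   conjugation. Only the laws used to build the objects below are recorded;
   the algebras of interest are the four values of [hurwitz]. *)
Record starAlg (R : realType) := StarAlg {
  star_sort :> lmodType R;
  kone : star_sort;
  kmul : star_sort -> star_sort -> star_sort;
  kconj : star_sort -> star_sort;
  kre : star_sort -> R;
  kconj_linear : linear kconj;
  kconjK : involutive kconj }.

Arguments kone {R s}.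
Arguments kmul {R s}.
Arguments kconj {R s}.
Arguments kre {R s}.

HB.instance Definition _ (R : realType) (K : starAlg R) :=
  GRing.isLinear.Build R K K *:%R (@kconj R K) (@kconj_linear R K).

Lemma real_conj_linear (R : realType) : linear (@idfun R^o).
Proof. by []. Qed.

Definition real_alg (R : realType) : starAlg R :=
  @StarAlg R R^o 1 *%R idfun idfun (@real_conj_linear R)
    (fun _ => erefl).

(* [Rcomplex R] is [R[i]] with its structure of real vector space. *)
Lemma complex_conj_linear (R : realType) :
  linear (conjc : Rcomplex R -> Rcomplex R).
Proof. by move=> a [x y] [z t]; congr Complex; rewrite /= mulrN opprD. Qed.

Definition complex_alg (R : realType) : starAlg R :=
  @StarAlg R (Rcomplex R) 1 *%R conjc (@complex.Re R)
    (@complex_conj_linear R) (@conjcK R).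

Section CayleyDickson.
Context (R : realType) (K : starAlg R).

Let KK : lmodType R := (K * K)%type.

Definition double_mul (x y : KK) : KK :=
  (kmul x.1 y.1 - kmul (kconj y.2) x.2, kmul y.2 x.1 + kmul x.2 (kconj y.1)).

Definition double_conj (x : KK) : KK := (kconj x.1, - x.2).

Lemma double_conj_linear : linear double_conj.
Proof.
by move=> a x y; congr pair => /=; rewrite ?linearP// opprD scalerN.
Qed.

Lemma double_conjK : involutive double_conj.
Proof. by case=> a b; rewrite /double_conj /= kconjK opprK. Qed.

Definition double_alg : starAlg R :=
  @StarAlg R KK (kone, 0) double_mul double_conj (fun x => kre x.1)
    double_conj_linear double_conjK.

End CayleyDickson.

Variant hurwitz_name := Reals | Complexes | Quaternions | Octonions.

Definition hurwitz (R : realType) (k : hurwitz_name) : starAlg R :=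
  match k with
  | Reals => real_alg R
  | Complexes => complex_alg R
  | Quaternions => double_alg (complex_alg R)
  | Octonions => double_alg (double_alg (complex_alg R))
  end.

Section ImaginaryPart.
Context (R : realType) (K : starAlg R).

Definition knorm (z : K) : R := Num.sqrt (kre (kmul z (kconj z))).

Definition kinv (z : K) : K := knorm z ^- 2 *: kconj z.

Definition imag : {pred K} := [pred z | z == - kconj z].

Lemma imag_submod_closed : submod_closed imag.
Proof.
split=> [|a x y]; rewrite !inE ?linear0 ?oppr0// => /eqP hx /eqP hy.
by rewrite linearP opprD -scalerN -hx -hy.
Qed.

HB.instance Definition _ := GRing.isSubmodClosed.Build R K imag
  imag_submod_closed.

Record imK := ImK { imval :> K; _ : imval \in imag }.

HB.instance Definition _ := [isSub for imval].
HB.instance Definition _ := [Choice of imK by <:].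
HB.instance Definition _ := [SubChoice_isSubLmodule of imK by <:].

Lemma impart_subproof (z : K) : 2^-1 *: (z - kconj z) \in imag.
Proof. by rewrite inE linearZ /= (linearB kconj) /= kconjK -scalerN opprB. Qed.

Definition impart (z : K) : imK := ImK (impart_subproof z).

Lemma imconj_subproof (v : imK) : kconj (v : K) \in imag.
Proof. by case: v => v /= /eqP hv; rewrite inE kconjK {2}hv opprK. Qed.

Definition imconj (v : imK) : imK := ImK (imconj_subproof v).

End ImaginaryPart.

(* The boundary is [option (heis K m)], with m = n - 1 and [None] the point
   at infinity. The additive group structure carried by the product type is
   not the Heisenberg group law, which is [heis_mul]. *)
Section Heisenberg.
Context (R : realType) (K : starAlg R) (m : nat).

Definition heis : Type := ('rV[K]_m * imK K)%type.

HB.instance Definition _ := Choice.copy heis ('rV[K]_m * imK K)%type.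

Definition vnorm2 (z : 'rV[K]_m) : R := \sum_i knorm (z ord0 i) ^+ 2.

Definition omega (z z' : 'rV[K]_m) : imK K :=
  impart (\sum_i kmul (kconj (z' ord0 i)) (z ord0 i)).

Definition heis_mul (p q : heis) : heis :=
  (p.1 + q.1, p.2 + q.2 + 2 *: omega p.1 q.1).

Definition heis_inv (p : heis) : heis := (- p.1, - p.2).

Definition origin : heis := (0, 0).

Definition gauge (p : heis) : R :=
  (vnorm2 p.1 ^+ 2 + knorm (p.2 : K) ^+ 2) `^ 4^-1.

Definition dheis (p q : heis) : R := gauge (heis_mul (heis_inv q) p).

Definition inversion (x : option heis) : option heis :=
  match x with
  | None => Some origin
  | Some p =>
      if p == origin then None
      else let w : K := - (vnorm2 p.1 *: kone) + (p.2 : K) in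
           Some (map_mx (fun z => kmul z (kinv w)) p.1,
                 knorm w ^- 2 *: imconj p.2)
  end.

End Heisenberg.

Arguments origin {R K m}.

Section ExtendedMetric.
Context (R : realType) (S : choiceType).

Definition is_metric (d : S -> S -> R) : Prop :=
  [/\ forall p q, 0 <= d p q,
      forall p q, d p q = 0 <-> p = q,
      forall p q, d p q = d q p &
      forall p q r, d p r <= d p q + d q r].

Definition dext (d : S -> S -> R) (x y : option S) : \bar R :=
  match x, y with
  | Some p, Some q => (d p q)%:E
  | None, None => 0%E
  | _, _ => +oo%E
  end.

(* Factors containing the point at infinity are replaced by 1: among pairwise
   distinct points it occurs in exactly one numerator and one denominator. *)
Definition cr_factor (d : S -> S -> R) (x y : option S) : R :=
  match x, y with
  | Some p, Some q => d p q
  | _, _ => 1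
  end.

Definition cross_ratio (d : S -> S -> R) (x1 x2 x3 x4 : option S) : R :=
  (cr_factor d x4 x2 / cr_factor d x4 x1) *
  (cr_factor d x3 x1 / cr_factor d x3 x2).

Definition dspace (o : S) (d : S -> S -> R) : Type := option S.

HB.instance Definition _ (o : S) (d : S -> S -> R) :=
  Choice.copy (dspace o d) (option S).

Section DTopology.
Variables (o : S) (d : S -> S -> R).

Definition dopen (U : set (dspace o d)) : Prop :=
  (forall p, U (Some p) ->
     exists2 e, 0 < e & forall q, d p q < e -> U (Some q)) /\
  (U None -> exists2 r, 0 < r & forall q, r < d o q -> U (Some q)).

Lemma dopenT : dopen setT.
Proof. by split=> *; exists 1. Qed.

Lemma dopenI : setI_closed dopen.
Proof.
move=> U V [U1 U2] [V1 V2]; split=> [p [Up Vp]|[UN VN]].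
  have [[e e0 He] [f f0 Hf]] := (U1 _ Up, V1 _ Vp).
  exists (Num.min e f); first by rewrite lt_min e0.
  by move=> q; rewrite lt_min => /andP[/He ? /Hf ?].
have [[e e0 He] [f f0 Hf]] := (U2 UN, V2 VN).
exists (Num.max e f); first by rewrite lt_max e0.
by move=> q; rewrite gt_max => /andP[/He ? /Hf ?].
Qed.

Lemma dopen_bigU (I : Type) (f : I -> set (dspace o d)) :
  (forall i, dopen (f i)) -> dopen (\bigcup_i f i).
Proof.
move=> fo; split=> [p [i _ fip]|[i _ fiN]]; have [f1 f2] := fo i.
  by have [e e0 He] := f1 _ fip; exists e => // q /He ?; exists i.
by have [e e0 He] := f2 fiN; exists e => // q /He ?; exists i.
Qed.

HB.instance Definition _ := isOpenTopological.Build (dspace o d)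
  dopenT dopenI dopen_bigU.

End DTopology.

Definition dhomeo (o : S) (d : S -> S -> R) (f : option S -> option S) :=
  exists g : option S -> option S,
    [/\ cancel f g, cancel g f,
        continuous (f : dspace o d -> dspace o d) &
        continuous (g : dspace o d -> dspace o d)].

Definition moebius (o : S) (d : S -> S -> R) : set (option S -> option S) :=
  [set f | dhomeo o d f /\
     forall x1 x2 x3 x4, uniq [:: x1; x2; x3; x4] ->
       cross_ratio d (f x1) (f x2) (f x3) (f x4) = cross_ratio d x1 x2 x3 x4].

Definition similarity (o : S) (d : S -> S -> R) : set (option S -> option S) :=
  [set f | moebius o d f /\
     exists2 k : R, 0 < k &
       forall p q : S,
         dext d (f (Some p)) (f (Some q)) =
         (k%:E * dext d (Some p) (Some q))%E].

Definition dconverges (o : S) (d : S -> S -> R) (u : nat -> option S) : Prop :=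
  exists l : dspace o d, (u : nat -> dspace o d) @ \oo --> l.

End ExtendedMetric.

(* Main.v *)
From HB Require Import structures.
Require Import Defs.
From mathcomp Require Import all_boot all_order all_algebra.
From mathcomp Require Import complex ring lra.
From mathcomp Require Import all_classical all_reals all_analysis.

Set Implicit Arguments.
Unset Strict Implicit.
Unset Printing Implicit Defensive.

Import Order.TTheory GRing.Theory Num.Theory.
Import numFieldNormedType.Exports.
Local Open Scope classical_set_scope.
Local Open Scope ring_scope.

Local Notation "x ** y" := (kmul x y) (at level 40, left associativity).

(** Write [N p] for the [d]-distance from the origin to [p], [o] for the origin
    and [|p|] for the gauge. The proof determines [N] and then transports the
    answer by translations.

    Left translations, dilations [D_r (z, v) = (r z, r^2 v)] and a supply of
    rotations are similarities of the Koranyi metric, hence of [d], each with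
    a scale factor for [d]. For a horizontal [g] one has [g * g = D_2 g], for a
    vertical one [g * g * g * g = D_2 g]. Since translation by [D_2 g] is
    conjugate under [D_2] to translation by [g], it has the same factor [k],
    so that [k^2 = k] or [k^4 = k] and [k = 1]. As horizontal and vertical
    elements generate the group, [d] is left invariant ([dmet_mull]). The
    factor of [D_r] is multiplicative in [r]. It is less than 1 for [r < 1],
    because [D_(r^n) p] tends to the origin for the Koranyi topology, hence
    for that of [d] ([dil_small]). A multiplicative function with this
    property is a power, so [N (D_r p) = r^a N p] for some [a > 0]
    ([dil_powR]).

    Invariance of the cross-ratio under the inversion [I], applied to the four
    points infinity, [o], [p], [q], says that [N p * N (I p)] is a constant [c]
    ([inversion_mul]). If [|p| = 1] and [p = (z, v)], then
    [I p = (z u, v)^-1] where [u = |z|^2 + v] is a unit element of [K]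
    ([inversion_unit]), and [N (q^-1) = N q] by left invariance. A rotation
    maps [(z, v)] to [(z u, v)] ([rotation_exists]) and rotations preserve
    [N], so [N p ^ 2 = c] on the whole unit sphere. Hence [N p = b |p|^a] and
    [d = b d_H^a]; the triangle inequality for [o], [p], [D_2 p] with [p]
    horizontal gives [2^a <= 2], that is [a <= 1] ([snowflake]).

    The rotation is immediate when [K] is associative: it is
    [(z, v) |-> (z u, u^-1 v u)]. For the octonions, [z |-> z x] with [x] a
    unit imaginary element still induces an isometry, acting on the vertical
    part as the half-turn [v |-> 2 <x, v> x - v] about [x]
    ([kip_conj_mulr], [rotation_imag]). If [x] is orthogonal to [v], there is a
    unit imaginary [y], also orthogonal to [v], with [(z x) y = z u]
    ([kmul_two_imag]), and the two half-turns send [v] to [- v] and back. This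
    uses the adjunction laws and the alternative law, which follow from the
    multiplicativity of the norm. *)

(** * Conic algebras with conjugation *)

(** The identities common to all Cayley-Dickson algebras over [R]: a bilinear
    product with unit, an anti-automorphism [x |-> 2 Re x - x], a symmetric
    trace form, and positivity of the norm form. No associativity is
    assumed, nor that the norm is multiplicative. *)
Record conic (R : realType) (K : starAlg R) : Prop := Conic {
  conic_mull : forall z : K, linear (fun x => x ** z);
  conic_mulr : forall z : K, linear (fun x => z ** x);
  conic_re : scalar (kre : K -> R);
  conic_1mul : left_id (kone : K) kmul;
  conic_mul1 : right_id (kone : K) kmul;
  conic_conjM : forall x y : K, kconj (x ** y) = kconj y ** kconj x;
  conic_conjE : forall x : K, kconj x = (2 * kre x) *: kone - x;
  conic_re1 : kre (kone : K) = 1;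
  conic_reC : forall x y : K, kre (x ** y) = kre (y ** x);
  conic_pos : forall x : K, x != 0 -> 0 < kre (x ** kconj x) }.

(** The inner product polarizing the square of [knorm]. *)
Definition kip (R : realType) (K : starAlg R) (x y : K) : R :=
  kre (x ** kconj y).

Section Conic.
Context (R : realType) (K : starAlg R) (hK : conic K).
Implicit Types (x y z : K) (a : R).

Lemma kmulDl x y z : (x + y) ** z = x ** z + y ** z.
Proof. by have := conic_mull hK z 1 x y; rewrite !scale1r. Qed.

Lemma kmulDr x y z : z ** (x + y) = z ** x + z ** y.
Proof. by have := conic_mulr hK z 1 x y; rewrite !scale1r. Qed.

Lemma kmul0l z : 0 ** z = 0.
Proof. by apply: (addrI (0 ** z)); rewrite -kmulDl !addr0. Qed.

Lemma kmul0r z : z ** 0 = 0.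
Proof. by apply: (addrI (z ** 0)); rewrite -kmulDr !addr0. Qed.

Lemma kmulZl a x z : (a *: x) ** z = a *: (x ** z).
Proof. by have := conic_mull hK z a x 0; rewrite kmul0l !addr0. Qed.

Lemma kmulZr a x z : z ** (a *: x) = a *: (z ** x).
Proof. by have := conic_mulr hK z a x 0; rewrite kmul0r !addr0. Qed.

Lemma kmulNl x z : (- x) ** z = - (x ** z).
Proof. by rewrite -scaleN1r kmulZl scaleN1r. Qed.

Lemma kmulNr x z : z ** (- x) = - (z ** x).
Proof. by rewrite -scaleN1r kmulZr scaleN1r. Qed.

Lemma kreD x y : kre (x + y) = kre x + kre y.
Proof. by have := conic_re hK 1 x y; rewrite scale1r mul1r. Qed.

Lemma kre0 : kre (0 : K) = 0.
Proof. by apply: (addrI (kre (0 : K))); rewrite -kreD !addr0. Qed.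

Lemma kreZ a x : kre (a *: x) = a * kre x.
Proof. by have := conic_re hK a x 0; rewrite kre0 !addr0. Qed.

Lemma kreN x : kre (- x) = - kre x.
Proof. by rewrite -scaleN1r kreZ mulN1r. Qed.

Lemma kconjN x : kconj (- x) = - kconj x.
Proof. exact: linearN. Qed.
Lemma kconjD x y : kconj (x + y) = kconj x + kconj y.
Proof. exact: linearD. Qed.
Lemma kconjZ a x : kconj (a *: x) = a *: kconj x.
Proof. exact: linearZ. Qed.
Lemma kconj0 : kconj (0 : K) = 0.
Proof. exact: linear0. Qed.

Lemma kconj1 : kconj kone = kone :> K.
Proof.
by rewrite (conic_conjE hK) (conic_re1 hK) mulr1 scaler_nat mulr2n addrK.
Qed.

Lemma kre_conj x : kre (kconj x) = kre x.
Proof.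
rewrite (conic_conjE hK) kreD kreN kreZ (conic_re1 hK); ring.
Qed.

Lemma kipDl x y z : kip (x + y) z = kip x z + kip y z.
Proof. by rewrite /kip kmulDl kreD. Qed.
Lemma kipZl a x z : kip (a *: x) z = a * kip x z.
Proof. by rewrite /kip kmulZl kreZ. Qed.
Lemma kipNl x z : kip (- x) z = - kip x z.
Proof. by rewrite /kip kmulNl kreN. Qed.
Lemma kip0l x : kip 0 x = 0.
Proof. by rewrite /kip kmul0l kre0. Qed.

Lemma kipC x y : kip x y = kip y x.
Proof. by rewrite /kip -kre_conj (conic_conjM hK) kconjK. Qed.

Lemma kipDr x y z : kip z (x + y) = kip z x + kip z y.
Proof. by rewrite ![kip z _]kipC kipDl. Qed.
Lemma kipZr a x z : kip z (a *: x) = a * kip z x.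
Proof. by rewrite ![kip z _]kipC kipZl. Qed.
Lemma kipNr x z : kip z (- x) = - kip z x.
Proof. by rewrite ![kip z _]kipC kipNl. Qed.
Lemma kip0r x : kip x 0 = 0.
Proof. by rewrite kipC kip0l. Qed.

Lemma kip1r x : kip x kone = kre x.
Proof. by rewrite /kip kconj1 (conic_mul1 hK). Qed.

Lemma kip_conj x y : kip (kconj x) (kconj y) = kip x y.
Proof. by rewrite /kip kconjK (conic_reC hK) -[RHS]/(kip x y) kipC. Qed.

Lemma kip_gt0 x : x != 0 -> 0 < kip x x.
Proof. exact: conic_pos. Qed.

Lemma kip_ge0 x : 0 <= kip x x.
Proof. by have [->|/kip_gt0/ltW//] := eqVneq x 0; rewrite kip0l. Qed.

Lemma kip_eq0 x : (kip x x == 0) = (x == 0).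
Proof.
by have [->|/kip_gt0 x0] := eqVneq x 0; rewrite ?kip0l ?eqxx// gt_eqF.
Qed.

Lemma kip_inj x y : (forall z, kip x z = kip y z) -> x = y.
Proof.
move=> h; apply/eqP; rewrite -subr_eq0 -kip_eq0 kipDl kipNl h subrr.
by [].
Qed.

Lemma kipxD x y : kip (x + y) (x + y) = kip x x + 2 * kip x y + kip y y.
Proof. rewrite kipDl !kipDr (kipC y x); ring. Qed.

Lemma kipxZ a x : kip (a *: x) (a *: x) = a ^+ 2 * kip x x.
Proof. rewrite kipZl kipZr; ring. Qed.

Lemma kipxN x : kip (- x) (- x) = kip x x.
Proof. by rewrite kipNl kipNr opprK. Qed.

Lemma kmul_conj x : x ** kconj x = kip x x *: kone.
Proof.
apply: (scalerI (_ : 2%:R != 0 :> R)); first by rewrite pnatr_eq0.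
have := conic_conjE hK (x ** kconj x).
rewrite (conic_conjM hK) kconjK -/(kip x x) => h.
by rewrite scalerA scaler_nat mulr2n {1}h subrK.
Qed.

Lemma kconj_mul x : kconj x ** x = kip x x *: kone.
Proof. by rewrite -{2}[x]kconjK kmul_conj kip_conj. Qed.

Lemma knorm_sqr x : knorm x ^+ 2 = kip x x.
Proof. by rewrite /knorm sqr_sqrtr ?kip_ge0. Qed.

Lemma imag_conj x : x \in @imag R K -> kconj x = - x.
Proof. by rewrite inE => /eqP {2}->; rewrite opprK. Qed.

Lemma imag_re x : x \in @imag R K -> kre x = 0.
Proof.
by move=> /imag_conj h; have := kre_conj x; rewrite h kreN => ?; lra.
Qed.

Lemma re_imag x : kre x = 0 -> x \in @imag R K.
Proof.
by move=> h; rewrite inE (conic_conjE hK) h mulr0 scale0r sub0r opprK.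
Qed.

End Conic.

(** * Composition algebras *)

(** Multiplicativity of the norm, in squared form. *)
Definition normed_mul (R : realType) (K : starAlg R) : Prop :=
  forall x y : K, kip (x ** y) (x ** y) = kip x x * kip y y.

Definition kassoc (R : realType) (K : starAlg R) : Prop :=
  associative (kmul : K -> K -> K).

Section Composition.
Context (R : realType) (K : starAlg R) (hK : conic K) (hM : normed_mul K).
Implicit Types (x y z u v : K) (a : R).

Lemma kip_mulr x y z : kip (x ** z) (y ** z) = kip x y * kip z z.
Proof.
have := hM (x + y) z.
rewrite (kmulDl hK) !(kipxD hK) !hM => h; lra.
Qed.

Lemma kip_mull x y z : kip (z ** x) (z ** y) = kip z z * kip x y.
Proof.
have := hM z (x + y).
rewrite (kmulDr hK) !(kipxD hK) !hM => h; lra.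
Qed.

(** The polarization in both factors of the multiplicativity of the norm, from
    which the adjunction and alternative laws follow. *)
Lemma kip_exchange x y z u :
  kip (x ** z) (y ** u) + kip (x ** u) (y ** z) = 2 * kip x y * kip z u.
Proof.
have := kip_mulr x y (z + u).
rewrite !(kmulDr hK) (kipxD hK) !(kipDl hK) !(kipDr hK) !kip_mulr => h; lra.
Qed.

Lemma kip_adjr x y z : kip (x ** z) y = kip x (y ** kconj z).
Proof.
have := kip_exchange x y z kone; rewrite !(conic_mul1 hK) (kip1r hK) => h.
rewrite (conic_conjE hK) (kmulDr hK) (kmulNr hK) (kmulZr hK) (conic_mul1 hK).
rewrite (kipDr hK) (kipNr hK) (kipZr hK); lra.
Qed.

Lemma kip_adjl x y z : kip (z ** x) y = kip x (kconj z ** y).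
Proof.
rewrite -[LHS](kip_conj hK) (conic_conjM hK) kip_adjr kconjK.
by rewrite -[LHS](kip_conj hK) (conic_conjM hK) !kconjK.
Qed.

Lemma kmulK x z : (x ** z) ** kconj z = kip z z *: x.
Proof.
apply: (kip_inj hK) => t.
by rewrite kip_adjr kconjK kip_mulr (kipZl hK) mulrC.
Qed.

Lemma kmulKV x z : kconj z ** (z ** x) = kip z z *: x.
Proof.
apply: (kip_inj hK) => t.
by rewrite kip_adjl kconjK kip_mull (kipZl hK).
Qed.

(** The linearization in [x] of the alternative law [kmulK]. *)
Lemma kmul_swap z x t : x \in @imag R K -> t \in @imag R K ->
  (z ** x) ** t + (z ** t) ** x = - (2 * kip x t) *: z.
Proof.
move=> hx ht; apply: (kip_inj hK) => w.
have E y := congr1 (fun s => kip s w) (kmulK z y).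
have := E (x + t); have := E x; have := E t; rewrite /=.
rewrite kconjD (imag_conj hx) (imag_conj ht) !(kmulDr hK) !(kmulDl hK).
rewrite !(kmulNr hK) (kipxD hK) !(kipDl hK) !(kipNl hK) !(kipZl hK); lra.
Qed.

(** The effect of right multiplication by an imaginary [x] on the products
    [kconj z' ** z], whose imaginary parts define the Heisenberg group law: the
    imaginary part undergoes [w |-> 2 <x, w> x - <x, x> w]. *)
Lemma kip_conj_mulr z z' x t : x \in @imag R K -> t \in @imag R K ->
  kip (kconj (z' ** x) ** (z ** x)) t =
  2 * kip x t * kip (kconj z' ** z) x - kip x x * kip (kconj z' ** z) t.
Proof.
move=> hx ht; rewrite kip_adjl !(kip_adjl z _ (kconj z')) !kconjK.
have := congr1 (kip (z ** x)) (kmul_swap z' hx ht).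
rewrite (kipDr hK) (kipZr hK) kip_mulr (kip_adjr z z' x) (imag_conj hx).
rewrite (kmulNr hK).
rewrite (kipNr hK); lra.
Qed.

(** If [x] is a unit imaginary element orthogonal to [v], then right
    multiplication by the unit element [a + v] sends the given [z] to the same
    point as two successive right multiplications by unit imaginary elements
    orthogonal to [v]. Without associativity, the second one depends on [z]. *)
Lemma kmul_two_imag z x v a : x \in @imag R K -> v \in @imag R K ->
  kip x x = 1 -> kip x v = 0 -> a ^+ 2 + kip v v = 1 -> z != 0 ->
  exists y, [/\ y \in @imag R K, kip y y = 1, kip y v = 0 &
    (z ** x) ** y = z ** (a *: kone + v)].
Proof.
move=> hx hv x1 xv av z0; set u := a *: kone + v.
have z1 : kip z z != 0 by rewrite (kip_eq0 hK).
have re0 t : t \in @imag R K -> kip t kone = 0.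
  by move=> /(imag_re hK) <-; rewrite (kip1r hK).
have u1 : kip u u = 1.
  rewrite /u (kipxD hK) (kipxZ hK) (kipZl hK) (kipC hK kone v) (re0 v)//.
  by rewrite (kip1r hK kone) (conic_re1 hK); lra.
(* The left inverse of [z ** x], of norm [kip z z], applied to [z ** u]. *)
exists ((kip z z)^-1 *: (kconj (z ** x) ** (z ** u))); split.
- apply: (re_imag hK); rewrite (kreZ hK) -(kip1r hK) kip_adjl kconjK. 
  rewrite (conic_mul1 hK) kip_mull (kipC hK u) /u (kipDr hK) (kipZr hK).
  by rewrite re0// xv mulr0 addr0 !mulr0.
- rewrite (kipxZ hK) hM (kip_conj hK) !hM x1 u1; field.
  exact: z1.
- rewrite (kipZl hK) kip_adjl kconjK -{1}[v]kconjK -kip_adjr (imag_conj hv).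
  rewrite /u (kmulDr hK) (kmulZr hK) (conic_mul1 hK) (kmulNr hK).
  rewrite (kmulDl hK) (kmulZl hK).
  have := kmulK z v; rewrite (imag_conj hv) (kmulNr hK) => /eqP.
  rewrite eqr_oppLR => /eqP ->.
  have zx : kip z (z ** x) = 0.
    by rewrite -{1}[z](conic_mul1 hK) kip_mull (kipC hK) re0// mulr0.
  rewrite (kipNl hK) (kipDl hK) (kipNl hK) !(kipZl hK) kip_mull zx.
  by rewrite [kip v x](kipC hK) xv; ring.
- have := kmulKV (z ** u) (kconj (z ** x)); rewrite kconjK (kip_conj hK) hM x1.
  by rewrite mulr1 (kmulZr hK) => ->; rewrite scalerA mulVf// scale1r.
Qed.

End Composition.

Section Associative.
Context (R : realType) (K : starAlg R) (hK : conic K) (hA : kassoc K).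
Implicit Types (x y z u v : K) (a : R).

Lemma kassoc_normed : normed_mul K.
Proof.
move=> x y; rewrite {1}/kip (conic_conjM hK) hA -[x ** y ** _]hA.
rewrite (kmul_conj hK) (kmulZr hK) (conic_mul1 hK) (kmulZl hK) (kreZ hK).
by rewrite mulrC.
Qed.

End Associative.

(** * The Cayley-Dickson construction and the Hurwitz algebras *)

Section Doubling.
Context (R : realType) (K : starAlg R) (hK : conic K).

Lemma double_ip (x y : double_alg K) :
  kip x y = kip x.1 y.1 + kip x.2 y.2.
Proof.
rewrite /kip /= kconjN (kmulNl hK) opprK (kreD hK); congr (_ + _).
exact: (conic_reC hK).
Qed.

Lemma double_conic : conic (double_alg K).
Proof.
split.
- move=> z a x y; congr pair => /=.
    rewrite (kmulDl hK) (kmulDr hK) (kmulZl hK) (kmulZr hK) scalerBr opprD.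
    by rewrite addrACA.
  by rewrite (kmulDr hK) (kmulDl hK) (kmulZl hK) (kmulZr hK) scalerDr addrACA.
- move=> z a x y; congr pair => /=.
    rewrite (kmulDr hK) kconjD kconjZ (kmulDl hK).
    by rewrite (kmulZl hK) (kmulZr hK) scalerBr opprD addrACA.
  rewrite (kmulDl hK) kconjD kconjZ (kmulDr hK).
  by rewrite (kmulZl hK) (kmulZr hK) scalerDr addrACA.
- by move=> a x y; exact: (conic_re hK).
- case=> a b; congr pair => /=.
    by rewrite (conic_1mul hK) (kmul0r hK) subr0.
  by rewrite (conic_mul1 hK) (kmul0l hK) addr0.
- case=> a b; congr pair => /=.
    by rewrite kconj0 (conic_mul1 hK) (kmul0l hK) subr0.
  by rewrite (kmul0l hK) (kconj1 hK) (conic_mul1 hK) add0r.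
- case=> a b [c e]; congr pair => /=.
    rewrite kconjD kconjN !(conic_conjM hK) kconjK kconjN.
    by rewrite (kmulNl hK) (kmulNr hK) opprK.
  by rewrite kconjK (kmulNl hK) (kmulNl hK) opprD addrC.
- case=> a b; congr pair => /=; first exact: (conic_conjE hK).
  by rewrite scaler0 sub0r.
- exact: (conic_re1 hK).
- case=> a b [c e] /=; rewrite !(kreD hK) !(kreN hK) (conic_reC hK a c).
  by rewrite -(kre_conj hK (_ ** b)) (conic_conjM hK) kconjK.
- case=> a b ab; rewrite -/(kip _ _) double_ip /=.
  have [a0|a0] := eqVneq a 0; last first.
    by rewrite ltr_wpDr ?(kip_ge0 hK)// (kip_gt0 hK).
  have b0 : b != 0.
    by apply: contraNneq ab => b0; rewrite a0 b0.
  by rewrite ltr_wpDl ?(kip_ge0 hK)// (kip_gt0 hK).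
Qed.

(** The norm of the double of an associative algebra is multiplicative: the two
    cross terms cancel. *)
Lemma double_normed : kassoc K -> normed_mul (double_alg K).
Proof.
move=> hA; have hM := kassoc_normed hK hA.
case=> a b [c e]; rewrite !double_ip /=.
rewrite !(kipxD hK) (kipxN hK) !(kipNr hK) !hM !(kip_conj hK).
have -> : kip (a ** c) (kconj e ** b) = kip (e ** a) (b ** kconj c).
  by rewrite -(kip_adjr hK hM) -hA (kip_adjl hK hM (a ** c)).
ring.
Qed.

End Doubling.

Section Hurwitz.
Context (R : realType).

Lemma complex_conic : conic (complex_alg R).
Proof.
split.
- by move=> z a x y; rewrite /= mulrDl scalerAl.
- move=> [z t] a [x y] [x' y']; congr Complex => /=; ring.
- by move=> a [x y] [z t].
- exact: mul1r.
- exact: mulr1.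
- by move=> x y; rewrite [RHS]mulrC; exact: rmorphM.
- move=> [x y]; congr Complex => /=; ring.
- by [].
- by move=> x y; rewrite /= mulrC.
- move=> [x y]; rewrite eq_complex /= negb_and => h.
  rewrite mulrN opprK -!expr2.
  have [x0|x0] := eqVneq x 0; last first.
    by rewrite ltr_wpDr ?sqr_ge0// exprn_even_gt0.
  move: h; rewrite x0 eqxx /= => h.
  by rewrite ltr_wpDl ?sqr_ge0// exprn_even_gt0.
Qed.

Lemma complex_assoc : kassoc (complex_alg R).
Proof. exact: mulrA. Qed.

Lemma quaternion_assoc : kassoc (double_alg (complex_alg R)).
Proof.
move=> [[a1 a2] [b1 b2]] [[c1 c2] [d1 d2]] [[e1 e2] [f1 f2]].
congr pair; congr Complex => /=; ring.
Qed.

Lemma hurwitz_conic k : k <> Reals -> conic (hurwitz R k).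
Proof.
case: k => // _.
- exact: complex_conic.
- exact/double_conic/complex_conic.
- exact/double_conic/double_conic/complex_conic.
Qed.

Lemma hurwitz_assoc k : k <> Reals -> k <> Octonions -> kassoc (hurwitz R k).
Proof.
by case: k => // _ _; [exact: complex_assoc | exact: quaternion_assoc].
Qed.

Lemma hurwitz_normed k : k <> Reals -> normed_mul (hurwitz R k).
Proof.
move=> kR; have [->|kO] := pselect (k = Octonions); last first.
  exact: kassoc_normed (hurwitz_conic kR) (hurwitz_assoc kR kO).
exact/double_normed/quaternion_assoc/double_conic/complex_conic.
Qed.

Lemma octonion_orthogonal (v : hurwitz R Octonions) :
  exists x, [/\ x \in @imag R (hurwitz R Octonions), kip x x = 1 &
                kip x v = 0].
Proof.
set H := double_alg (complex_alg R).
have hH : conic H by exact/double_conic/complex_conic.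
have hHM : normed_mul H by apply: kassoc_normed => //; exact: quaternion_assoc.
have [b b1 bv] : exists2 b : H, kip b b = 1 & kip b v.2 = 0.
  have [->|v0] := eqVneq v.2 0.
    by exists kone; rewrite ?(kip0r hH)// (kip1r hH) (conic_re1 hH).
  (* Left multiplication by a unit imaginary [i] is skew-symmetric. *)
  pose i : H := (0, kone).
  have i1 : kip i i = 1.
    rewrite double_ip ?(kip0l complex_conic) ?add0r; last exact: complex_conic.
    by rewrite (kip1r complex_conic) (conic_re1 complex_conic).
  exists ((knorm v.2)^-1 *: (i ** v.2)).
    rewrite (kipxZ hH) hHM i1 mul1r exprVn (knorm_sqr hH) mulVf//.
    by rewrite (kip_eq0 hH).
  rewrite (kipZl hH) -{3}[v.2](conic_1mul hH) (kip_mulr hH hHM).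
  by rewrite (kip1r hH) mul0r mulr0.
exists (0, b); split.
- by apply: (re_imag (double_conic hH)); exact: (kre0 hH).
- by rewrite (double_ip hH) [X in X + _](kip0l hH) add0r.
- by rewrite (double_ip hH) [X in X + _](kip0l hH) add0r.
Qed.

End Hurwitz.

(** * Imaginary parts *)

Section ImaginaryPart.
Context (R : realType) (K : starAlg R) (hK : conic K).
Implicit Types (x y z u v : K) (a : R).

Lemma imvalP (v : imK K) : (v : K) \in @imag R K.
Proof. by case: v. Qed.

Lemma impartE z : impart z = 2^-1 *: (z - kconj z) :> K.
Proof. by []. Qed.

Lemma impartD x y : impart (x + y) = impart x + impart y.
Proof.
by apply: val_inj; rewrite raddfD /= -scalerDr kconjD opprD addrACA.
Qed.

Lemma impartZ a x : impart (a *: x) = a *: impart x.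
Proof.
by apply: val_inj; rewrite linearZ /= kconjZ -scalerBr !scalerA mulrC.
Qed.

Lemma impart0 : impart 0 = 0 :> imK K.
Proof. by rewrite -[X in impart X](scale0r 0) impartZ scale0r. Qed.

Lemma impart_conj x : impart (kconj x) = - impart x.
Proof.
by apply: val_inj; rewrite raddfN /= kconjK -scalerN opprB.
Qed.

Lemma impart_id v : v \in @imag R K -> imval (impart v) = v.
Proof.
move=> hv; rewrite impartE (imag_conj hv) opprK -mulr2n.
rewrite -[v *+ 2]scaler_nat scalerA.
by rewrite mulVf ?pnatr_eq0// scale1r.
Qed.

Lemma impart_im (v : imK K) : impart (v : K) = v.
Proof. by apply: val_inj; exact: impart_id (imvalP v). Qed.

Lemma impart_eq x (v : imK K) : x = v -> impart x = v.
Proof. by move=> ->; exact: impart_im. Qed.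

Lemma impart_sum (I : Type) (r : seq I) (P : pred I) (F : I -> K) :
  impart (\sum_(i <- r | P i) F i) = \sum_(i <- r | P i) impart (F i).
Proof. exact: (big_morph _ impartD impart0). Qed.

Lemma kip_impart z t : t \in @imag R K -> kip (impart z) t = kip z t.
Proof.
move=> ht; rewrite impartE (kipZl hK) (kipDl hK) (kipNl hK).
rewrite -{2}[t]kconjK (kip_conj hK) (imag_conj ht) (kipNr hK); lra.
Qed.

(** The norm form is nondegenerate on the imaginary part. *)
Lemma imag_inj x y : x \in @imag R K -> y \in @imag R K ->
  (forall t, t \in @imag R K -> kip x t = kip y t) -> x = y.
Proof.
move=> hx hy h; apply/eqP; rewrite -subr_eq0 -(kip_eq0 hK) (kipDl hK).
by rewrite (kipNl hK) h ?subrr// rpredB.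
Qed.

Lemma kip_impart_le z : kip (impart z) (impart z) <= kip z z.
Proof.
have e : z = kre z *: kone + (impart z : K).
  rewrite impartE (conic_conjE hK) opprB addrA -[z + z]mulr2n.
  rewrite -[z *+ 2]scaler_nat scalerBr !scalerA mulrA.
  by rewrite mulVf ?pnatr_eq0// mul1r scale1r addrC subrK.
rewrite {3 4}e (kipxD hK) (kipxZ hK) (kipZl hK) (kipC hK kone (impart z)).
rewrite !(kip1r hK).
rewrite (imag_re hK (imvalP (impart z))) (conic_re1 hK).
by rewrite !mulr0 addr0 mulr1 lerDr sqr_ge0.
Qed.

End ImaginaryPart.

(** * The Heisenberg group and its gauge *)

Section Heis.
Context (R : realType) (K : starAlg R) (m : nat).
Context (hK : conic K) (hM : normed_mul K).
Implicit Types (z w : 'rV[K]_m) (p q g : heis K m) (r : R).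

Lemma vnorm2E z : vnorm2 z = \sum_i kip (z ord0 i) (z ord0 i).
Proof. by apply: eq_bigr => i _; rewrite (knorm_sqr hK). Qed.

Lemma vnorm2_ge0 z : 0 <= vnorm2 z.
Proof. by rewrite vnorm2E; apply: sumr_ge0 => i _; exact: kip_ge0. Qed.

Lemma vnorm2_eq0 z : vnorm2 z = 0 -> z = 0.
Proof.
rewrite vnorm2E => /eqP; rewrite psumr_eq0 => [/allP h|i _]; last first.
  exact: kip_ge0.
apply/rowP => i; rewrite mxE; apply/eqP.
by have := h i (mem_index_enum i); rewrite /= (kip_eq0 hK).
Qed.

(** [K] being a real vector space and not a ring, matrices over it carry no
    scalar multiplication; that of row vectors is defined entrywise. *)
Definition vscale r z : 'rV[K]_m := map_mx ( *:%R r) z.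

Lemma vscale0 z : vscale 0 z = 0.
Proof. by apply/rowP => i; rewrite !mxE scale0r. Qed.

Lemma vscaleN1 z : vscale (-1) z = - z.
Proof. by apply/rowP => i; rewrite !mxE scaleN1r. Qed.

Lemma vscaleDr r z w : vscale r (z + w) = vscale r z + vscale r w.
Proof. by apply/rowP => i; rewrite !mxE scalerDr. Qed.

Lemma vnorm2Z r z : vnorm2 (vscale r z) = r ^+ 2 * vnorm2 z.
Proof.
by rewrite !vnorm2E mulr_sumr; apply: eq_bigr => i _; rewrite mxE (kipxZ hK).
Qed.

Lemma vnorm2_0 : vnorm2 (0 : 'rV[K]_m) = 0.
Proof. by rewrite -(vscale0 0) vnorm2Z expr2 !mul0r. Qed.

Lemma vnorm2N z : vnorm2 (- z) = vnorm2 z.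
Proof. by rewrite -vscaleN1 vnorm2Z sqrrN expr1n mul1r. Qed.

Lemma vnorm2D_le z w : vnorm2 (z + w) <= 2 * vnorm2 z + 2 * vnorm2 w.
Proof.
rewrite !vnorm2E !mulr_sumr -big_split /=; apply: ler_sum => i _.
rewrite mxE (kipxD hK).
have := kip_ge0 hK (z ord0 i - w ord0 i).
rewrite (kipxD hK) (kipNr hK) (kipxN hK) => h; lra.
Qed.

(** The fourth power of the gauge. *)
Definition gauge4 p : R := vnorm2 p.1 ^+ 2 + knorm (p.2 : K) ^+ 2.

Lemma gauge4_ge0 p : 0 <= gauge4 p.
Proof. by rewrite addr_ge0 ?sqr_ge0. Qed.

Lemma gauge_ge0 p : 0 <= gauge p.
Proof. exact: powR_ge0. Qed.

Lemma powR4K r : 0 <= r -> (r ^+ 4) `^ 4^-1 = r.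
Proof.
move=> r0; rewrite -powR_mulrn// -powRrM mulfV ?pnatr_eq0//.
by rewrite powRr1.
Qed.

Lemma gauge_expr4 p : gauge p ^+ 4 = gauge4 p.
Proof.
rewrite /gauge -powR_mulrn ?powR_ge0// -powRrM mulVf ?pnatr_eq0//.
by rewrite powRr1// gauge4_ge0.
Qed.

Lemma gauge_eq p q : gauge4 p = gauge4 q -> gauge p = gauge q.
Proof. by rewrite /gauge -/(gauge4 p) -/(gauge4 q) => ->. Qed.

Lemma knormZ r (x : K) : knorm (r *: x) ^+ 2 = r ^+ 2 * knorm x ^+ 2.
Proof. by rewrite !(knorm_sqr hK) (kipxZ hK). Qed.

Lemma gauge_origin : gauge (origin : heis K m) = 0.
Proof.
rewrite /gauge /= vnorm2_0 (knorm_sqr hK) (kip0l hK) expr2 mulr0 addr0.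
by rewrite powR0// invr_neq0// pnatr_eq0.
Qed.

Lemma gauge_gt0 p : p != origin -> 0 < gauge p.
Proof.
move=> p0; rewrite lt_neqAle gauge_ge0 andbT eq_sym; apply: contra p0.
move=> /eqP h; have := gauge_expr4 p; rewrite h expr0n /= => /esym/eqP.
rewrite /gauge4 paddr_eq0 ?sqr_ge0// sqrf_eq0 (knorm_sqr hK) (kip_eq0 hK).
case: p {h} => z v /= /andP[/eqP/vnorm2_eq0 -> /eqP v0].
by apply/eqP; congr pair; apply: val_inj.
Qed.

Lemma gauge_inv p : gauge (heis_inv p) = gauge p.
Proof.
apply: gauge_eq; rewrite /gauge4 /= vnorm2N !(knorm_sqr hK).
by rewrite (kipxN hK).
Qed.

Lemma omegaDl z w z' : omega (z + w) z' = omega z z' + omega w z'.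
Proof.
rewrite /omega -impartD -big_split /=; congr impart.
by apply: eq_bigr => i _; rewrite mxE (kmulDr hK).
Qed.

Lemma omegaC z z' : omega z z' = - omega z' z.
Proof.
rewrite /omega -impart_conj raddf_sum /=; congr impart.
by apply: eq_bigr => i _; rewrite (conic_conjM hK) kconjK.
Qed.

Lemma omegaDr z w z' : omega z' (z + w) = omega z' z + omega z' w.
Proof. by rewrite omegaC omegaDl opprD -!omegaC. Qed.

Lemma omegaZl r z z' : omega (vscale r z) z' = r *: omega z z'.
Proof.
rewrite /omega -impartZ scaler_sumr; congr impart.
by apply: eq_bigr => i _; rewrite mxE (kmulZr hK).
Qed.

Lemma omegaZr r z z' : omega z (vscale r z') = r *: omega z z'.
Proof. by rewrite omegaC omegaZl -scalerN -omegaC. Qed.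

Lemma omegaNl z z' : omega (- z) z' = - omega z z'.
Proof. by rewrite -vscaleN1 omegaZl scaleN1r. Qed.

Lemma omegaNr z z' : omega z (- z') = - omega z z'.
Proof. by rewrite -vscaleN1 omegaZr scaleN1r. Qed.

Lemma omega_diag z : omega z z = 0.
Proof.
apply/eqP; have := omegaC z z => /eqP; rewrite -addr_eq0 -mulr2n.
by rewrite -scaler_nat scaler_eq0 pnatr_eq0.
Qed.

Lemma omega0r z : omega z 0 = 0.
Proof. by rewrite -(vscale0 0) omegaZr scale0r. Qed.

Lemma omega0l z : omega 0 z = 0.
Proof. by rewrite omegaC omega0r oppr0. Qed.

Lemma heis_mulA g p q : heis_mul g (heis_mul p q) = heis_mul (heis_mul g p) q.
Proof.
congr pair => /=; first by rewrite addrA.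
rewrite omegaDl omegaDr !scalerDr -!addrA; do 2 congr (_ + _).
by rewrite [RHS]addrCA; congr (_ + _); rewrite addrC -addrA.
Qed.


Lemma heis_mul0 p : heis_mul p origin = p.
Proof. by case: p => z v; rewrite /heis_mul /= omega0r scaler0 !addr0. Qed.

Lemma heis_0mul p : heis_mul origin p = p.
Proof.
by case: p => z v; rewrite /heis_mul /= omega0l scaler0 !add0r addr0.
Qed.

Lemma heis_mulV p : heis_mul p (heis_inv p) = origin.
Proof.
by rewrite /heis_mul /= omegaNr omega_diag oppr0 scaler0 addr0 !subrr.
Qed.

Lemma heis_invK : involutive (@heis_inv R K m).
Proof. by case=> z v; rewrite /heis_inv /= !opprK. Qed.

Lemma heis_mulVp p : heis_mul (heis_inv p) p = origin.
Proof. by rewrite -{2}[p]heis_invK heis_mulV. Qed.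

Lemma heis_inv_mul p q :
  heis_inv (heis_mul p q) = heis_mul (heis_inv q) (heis_inv p).
Proof.
rewrite /heis_inv /heis_mul /=; congr pair; first by rewrite opprD addrC.
by rewrite omegaNl omegaNr opprK (omegaC q.1) !opprD scalerN [- p.2 - _]addrC.
Qed.

Lemma heis_mulK g : cancel (heis_mul g) (heis_mul (heis_inv g)).
Proof. by move=> p; rewrite heis_mulA heis_mulVp heis_0mul. Qed.

Lemma heis_mulVK g : cancel (heis_mul (heis_inv g)) (heis_mul g).
Proof. by move=> p; rewrite heis_mulA heis_mulV heis_0mul. Qed.

Lemma dheis_mull g p q : dheis (heis_mul g p) (heis_mul g q) = dheis p q.
Proof. by rewrite /dheis heis_inv_mul -heis_mulA heis_mulK. Qed.

(** The dilation [D_r], an automorphism of the group that multiplies the gauge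
    by [r >= 0]. *)
Definition heis_dil r p : heis K m := (vscale r p.1, r ^+ 2 *: p.2).

Lemma heis_dilM r p q :
  heis_dil r (heis_mul p q) = heis_mul (heis_dil r p) (heis_dil r q).
Proof.
rewrite /heis_dil /heis_mul /=; congr pair; first exact: vscaleDr.
rewrite omegaZl omegaZr !scalerDr !scalerA; congr (_ + _ *: _).
by rewrite mulrC expr2.
Qed.

Lemma heis_dilV r p : heis_dil r (heis_inv p) = heis_inv (heis_dil r p).
Proof. rewrite /heis_dil /heis_inv /= scalerN; congr pair.
by apply/rowP => i; rewrite !mxE scalerN. Qed.

Lemma heis_dil_comp r s p : heis_dil r (heis_dil s p) = heis_dil (r * s) p.
Proof. rewrite /heis_dil /= scalerA exprMn; congr pair.
by apply/rowP => i; rewrite !mxE scalerA. Qed.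

Lemma heis_dil1 p : heis_dil 1 p = p.
Proof. case: p => z v; rewrite /heis_dil /= expr1n scale1r; congr pair.
by apply/rowP => i; rewrite !mxE scale1r. Qed.

Lemma heis_dil_origin r : heis_dil r origin = origin.
Proof. rewrite /heis_dil /= scaler0; congr pair.
by apply/rowP => i; rewrite !mxE scaler0. Qed.

Lemma gauge_dil r p : 0 <= r -> gauge (heis_dil r p) = r * gauge p.
Proof.
move=> r0.
have e : gauge4 (heis_dil r p) = r ^+ 4 * gauge4 p.
  by rewrite /gauge4 /= vnorm2Z knormZ; ring.
rewrite /gauge -/(gauge4 _) e powRM ?exprn_ge0 ?gauge4_ge0//.
by rewrite powR4K.
Qed.

Lemma dheis_dil r p q : 0 <= r ->
  dheis (heis_dil r p) (heis_dil r q) = r * dheis p q.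
Proof. by move=> r0; rewrite /dheis -heis_dilV -heis_dilM gauge_dil. Qed.

Lemma dheis_origin p : dheis p origin = gauge p.
Proof.
rewrite /dheis; congr gauge; rewrite -[RHS]heis_0mul; congr heis_mul.
by rewrite /heis_inv /= !oppr0.
Qed.

Lemma dheis_originl p : dheis origin p = gauge p.
Proof. by rewrite /dheis heis_mul0 gauge_inv. Qed.

Lemma kip_sum_le (I : Type) (s : seq I) : exists2 C : R, 0 <= C &
  forall F : I -> K, kip (\sum_(i <- s) F i) (\sum_(i <- s) F i) <=
                     C * \sum_(i <- s) kip (F i) (F i).
Proof.
elim: s => [|i s [C C0 IH]].
  by exists 0 => // F; rewrite !big_nil (kip0l hK) mulr0.
exists (2 + 2 * C) => [|F]; first by lra.
rewrite !big_cons; have := IH F.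
set S := \sum_(j <- s) _; set T := \sum_(j <- s) _ => h.
have := kip_ge0 hK (F i - S); have := kip_ge0 hK (F i).
have : 0 <= T by apply: sumr_ge0 => j _; exact: kip_ge0.
rewrite !(kipxD hK) (kipNr hK) (kipxN hK).
move: (kip _ _) h (kip _ _) (kip _ _) => a h b c T0 b0 hh.
nra.
Qed.

Lemma kip_omega_le : exists2 C : R, 0 <= C & forall z w,
  kip (omega z w : K) (omega z w : K) <= C * (vnorm2 z * vnorm2 w).
Proof.
have [C C0 h] := kip_sum_le (index_enum 'I_m).
exists C => // z w; apply: le_trans (kip_impart_le hK _) _.
apply: le_trans (h _) _; rewrite ler_wpM2l//.
rewrite !vnorm2E mulr_suml; apply: ler_sum => i _.
rewrite hM (kip_conj hK) mulrC ler_wpM2l ?(kip_ge0 hK)//.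
rewrite (bigD1 i)//= lerDl; apply: sumr_ge0 => j _; exact: kip_ge0.
Qed.

(** A quasi-triangle inequality. Its constant is irrelevant, since it only
    serves to compare neighbourhoods of infinity. *)
Lemma gauge4_mul_le : exists2 C : R, 0 <= C & forall p q,
  gauge4 (heis_mul p q) <= C * (gauge4 p + gauge4 q).
Proof.
have [C C0 hC] := kip_omega_le.
exists (8 + 8 * C) => [|p q]; first by lra.
have n (x y : K) : kip (x + y) (x + y) <= 2 * kip x x + 2 * kip y y.
  have := kip_ge0 hK (x - y).
  rewrite !(kipxD hK) (kipNr hK) (kipxN hK) => h; lra.
have hs := vnorm2D_le p.1 q.1.
have ho := hC p.1 q.1.
have a0 := vnorm2_ge0 p.1; have b0 := vnorm2_ge0 q.1.
have s0 := vnorm2_ge0 (p.1 + q.1).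
have hv := n (p.2 : K) (q.2 : K).
have hx := n ((p.2 : K) + (q.2 : K)) (2 *: (omega p.1 q.1 : K)).
have v0 := kip_ge0 hK (p.2 : K); have w0 := kip_ge0 hK (q.2 : K).
rewrite (kipxZ hK) in hx.
rewrite /gauge4 !(knorm_sqr hK) [(heis_mul p q).1]/=.
have -> : imval (heis_mul p q).2 =
  ((p.2 : K) + (q.2 : K)) + 2 *: (omega p.1 q.1 : K) by [].
set a := vnorm2 p.1 in hs ho a0 *; set b := vnorm2 q.1 in hs ho b0 *.
set s := vnorm2 (p.1 + q.1) in hs s0 *.
set v := kip (imval p.2) (imval p.2) in hv v0 *.
set w := kip (imval q.2) (imval q.2) in hv w0 *.
set X := kip (_ + _) (_ + _) in hx *.
set Y := kip (_ + _) (_ + _) in hv hx.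
set o := kip _ _ in ho hx.
have hs2 : s ^+ 2 <= 8 * (a ^+ 2 + b ^+ 2).
  have : s ^+ 2 <= (2 * a + 2 * b) ^+ 2 by rewrite lerXn2r ?nnegrE//; lra.
  by have := sqr_ge0 (a - b); lra.
have hab : C * (a * b) <= C * (a ^+ 2 + b ^+ 2).
  by rewrite ler_wpM2l//; have := sqr_ge0 (a - b); have := mulr_ge0 a0 b0; lra.
have hv2 : 0 <= C * (v + w) by rewrite mulr_ge0// addr_ge0.
lra.
Qed.

(** Far from the origin means far from any given point. *)
Lemma dheis_proper p r : exists2 r' : R, 0 < r' &
  forall q, r' < dheis origin q -> r < dheis p q.
Proof.
have [C C0 hC] := gauge4_mul_le.
exists (1 + C * (`|r| ^+ 4 + gauge4 p)) => [|q].
  by rewrite ltr_pwDl// mulr_ge0// addr_ge0 ?gauge4_ge0// exprn_ge0.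
have B0 : 0 <= C * (`|r| ^+ 4 + gauge4 p).
  by rewrite mulr_ge0// addr_ge0 ?gauge4_ge0// exprn_ge0.
rewrite dheis_originl; apply: contraTT; rewrite -!leNgt => h.
have h4 : gauge q ^+ 4 <= C * (`|r| ^+ 4 + gauge4 p).
  have := hC (heis_mul (heis_inv q) p) (heis_inv p).
  rewrite -heis_mulA heis_mulV heis_mul0 -!gauge_expr4 !gauge_inv => /le_trans.
  apply; rewrite ler_wpM2l// lerD2r lerXn2r ?nnegrE ?gauge_ge0//.
  exact: le_trans h (ler_norm r).
have [g1|g1] := leP (gauge q) 1; first by rewrite (le_trans g1)// lerDl.
apply: le_trans (@ler_eXnr _ (gauge q) 4 isT (ltW g1)) (le_trans h4 _).
by rewrite lerDr.
Qed.

End Heis.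

(** * Similarities from dilations *)

Section Similarities.
Context (R : realType) (S : choiceType) (o : S) (d : S -> S -> R).

Lemma cross_ratio_scale (f : S -> S) (k : R) x1 x2 x3 x4 : k != 0 ->
  (forall p q, d (f p) (f q) = k * d p q) -> uniq [:: x1; x2; x3; x4] ->
  cross_ratio d (omap f x1) (omap f x2) (omap f x3) (omap f x4) =
  cross_ratio d x1 x2 x3 x4.
Proof.
move=> k0 fk.
have kk a b : (k * a) / (k * b) = a / b by rewrite -mulf_div divff// mul1r.
have kkV a b : (k * a)^-1 * (k * b) = a^-1 * b.
  by rewrite mulrC kk mulrC.
rewrite /cross_ratio; case: x1 x2 x3 x4 => [p1|] [p2|] [p3|] [p4|];
  rewrite /= ?inE ?eqxx ?orbT ?andbF// => _.
all: by rewrite ?fk ?divr1 ?mul1r ?mulr1 ?kk ?kkV.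
Qed.

(** Continuity at infinity needs that points far from [o] be far from any given
    point. It is a hypothesis here because [d] need not be a metric. *)
Lemma dilation_continuous (f g : S -> S) (k : R) : 0 < k ->
  (forall p q, d (f p) (f q) = k * d p q) -> cancel g f ->
  (forall p r, exists2 r' : R, 0 < r' & forall q, r' < d o q -> r < d p q) ->
  continuous (omap f : dspace o d -> dspace o d).
Proof.
move=> k0 fk gK proper; apply/continuousP => U [U1 U2].
split=> [p /U1[e e0 h]|/U2[r r0 h]].
  exists (e / k) => [|q pq]; first by rewrite divr_gt0.
  by apply: h; rewrite fk mulrC -ltr_pdivlMr.
have [r' r'0 h'] := proper (g o) (r / k).
exists r' => // q /h' oq; apply: h.
by rewrite -[X in d X _](gK o) fk mulrC -ltr_pdivrMr.
Qed.

Lemma dilation_similarity (f g : S -> S) (k : R) : 0 < k ->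
  (forall p q, d (f p) (f q) = k * d p q) -> cancel f g -> cancel g f ->
  (forall p r, exists2 r' : R, 0 < r' & forall q, r' < d o q -> r < d p q) ->
  similarity o d (omap f).
Proof.
move=> k0 fk fK gK proper; split; last first.
  by exists k => // p q; rewrite /= fk.
split; last first.
  by move=> *; apply: cross_ratio_scale fk _ => //; rewrite gt_eqF.
exists (omap g); split.
- by case=> //= p; rewrite fK.
- by case=> //= p; rewrite gK.
- exact: dilation_continuous fk gK proper.
- apply: (dilation_continuous (k := k^-1)) fK proper; first by rewrite invr_gt0.
  by move=> p q; rewrite -{2}[p]gK -{2}[q]gK fk mulKf// gt_eqF.
Qed.

Lemma similarity_scale (f : S -> S) : similarity o d (omap f) ->
  exists2 k : R, 0 < k & forall p q, d (f p) (f q) = k * d p q.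
Proof. by case=> _ [k k0 h]; exists k => // p q; have [] := h p q. Qed.

End Similarities.

(** * Rotations of the Heisenberg group *)

Section Rotations.
Context (R : realType) (K : starAlg R) (m : nat).
Context (hK : conic K) (hM : normed_mul K).
Implicit Types (x y u v : K) (z w : 'rV[K]_m) (p q : heis K m) (r : R).

(** Bijective isometries of the Koranyi gauge distance that fix the origin and
    preserve the horizontal subspace. *)
Definition rotation (f : heis K m -> heis K m) : Prop :=
  [/\ bijective f, forall p q, dheis (f p) (f q) = dheis p q,
      f origin = origin & forall p, p.2 = 0 -> (f p).2 = 0].

Lemma rotation_comp f g : rotation f -> rotation g -> rotation (f \o g).
Proof.
move=> [fb fd f0 f2] [gb gd g0 g2]; split.
- exact: bij_comp.
- by move=> p q; rewrite /= fd gd.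
- by rewrite /= g0.
- by move=> p /g2/f2.
Qed.

(** The map acting by [f] on each horizontal coordinate and by [t] on the
    vertical part. Taking [impart] after [t] only serves to land in the
    imaginary part: [t] is meant to preserve it. *)
Definition heis_map (f t : K -> K) p : heis K m :=
  (map_mx f p.1, impart (t p.2)).

Lemma heis_map_can (f f' t t' : K -> K) : cancel f f' ->
  (forall v, v \in @imag R K -> t v \in @imag R K) ->
  (forall v, v \in @imag R K -> t' (t v) = v) ->
  cancel (heis_map f t) (heis_map f' t').
Proof.
move=> fK ti tK [z v]; congr pair; first by apply/rowP => i; rewrite !mxE fK.
by apply: impart_eq; rewrite impart_id ?tK ?ti ?imvalP.
Qed.

Lemma heis_map_rotation (f f' t t' : K -> K) :
  linear f -> linear t -> cancel f f' -> cancel f' f ->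
  (forall v, v \in @imag R K -> t v \in @imag R K) ->
  (forall v, v \in @imag R K -> t' v \in @imag R K) ->
  (forall v, v \in @imag R K -> t' (t v) = v) ->
  (forall v, v \in @imag R K -> t (t' v) = v) ->
  (forall x, kip (f x) (f x) = kip x x) ->
  (forall v, v \in @imag R K -> kip (t v) (t v) = kip v v) ->
  (forall x y, impart (kconj (f y) ** f x) = t (impart (kconj y ** x)) :> K) ->
  rotation (heis_map f t).
Proof.
move=> fl tl fK gK ti t'i tK t'K fn tn ft.
pose F : {linear K -> K} := HB.pack f (GRing.isLinear.Build R K K *:%R f fl).
pose T : {linear K -> K} := HB.pack t (GRing.isLinear.Build R K K *:%R t tl).
pose Ti (v : imK K) := impart (t v).
have TiD (v w : imK K) : Ti (v + w) = Ti v + Ti w.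
  by rewrite /Ti -impartD; congr impart; exact: (raddfD T).
have TiZ r (v : imK K) : Ti (r *: v) = r *: Ti v.
  by rewrite /Ti -impartZ; congr impart; exact: (linearZZ T r (imval v)).
have Ti0 : Ti 0 = 0 by have := TiZ 0 0; rewrite !scale0r.
have TiN (v : imK K) : Ti (- v) = - Ti v by rewrite -scaleN1r TiZ scaleN1r.
have mapM p q : heis_map f t (heis_mul p q) =
                heis_mul (heis_map f t p) (heis_map f t q).
  rewrite /heis_map /heis_mul /=; congr pair.
    by apply/rowP => i; rewrite !mxE -[f]/(F : K -> K) raddfD.
  rewrite -[impart (t _)]/(Ti (p.2 + q.2 + 2 *: omega p.1 q.1)) !TiD TiZ.
  congr (_ + 2 *: _); rewrite /omega !impart_sum (big_morph Ti TiD Ti0).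
  by apply: eq_bigr => i _; apply: impart_eq; rewrite !mxE ft.
have mapV p : heis_map f t (heis_inv p) = heis_inv (heis_map f t p).
  rewrite /heis_map /heis_inv /=; congr pair; last exact: TiN.
  by apply/rowP => i; rewrite !mxE -[f]/(F : K -> K) raddfN.
split.
- by exists (heis_map f' t'); exact: heis_map_can.
- move=> p q; rewrite /dheis -mapV -mapM; apply: gauge_eq.
  set x := heis_mul _ _.
  have e : imval (heis_map f t x).2 = t x.2.
    exact: impart_id (ti _ (imvalP _)).
  rewrite /gauge4 !(vnorm2E hK) !(knorm_sqr hK) e.
  rewrite tn ?imvalP//; congr (_ ^+ 2 + _).
  by apply: eq_bigr => i _; rewrite !mxE fn.
- congr pair.
    by apply/rowP => i; rewrite !mxE -[f]/(F : K -> K) raddf0.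
  exact: Ti0.
- by move=> p /= ->; exact: Ti0.
Qed.

(** For a unit [x], the half-turn about the line spanned by [x]. *)
Definition half_turn x v : K := (2 * kip x v) *: x - v.

Lemma rotation_imag x : x \in @imag R K -> kip x x = 1 ->
  rotation (heis_map (fun y => y ** x) (half_turn x)).
Proof.
move=> hx x1.
have xx y : y ** x ** x = - y.
  have := kmulK hK hM y x; rewrite (imag_conj hx) (kmulNr hK) x1 scale1r.
  by move=> /(congr1 -%R); rewrite opprK.
have ti v : v \in @imag R K -> half_turn x v \in @imag R K.
  by move=> hv; rewrite /half_turn rpredB// rpredZ.
have tx v : kip x (half_turn x v) = kip x v.
  rewrite /half_turn (kipDr hK) (kipNr hK) (kipZr hK) x1; ring.
have tK v : half_turn x (half_turn x v) = v.
  by rewrite {1}/half_turn tx /half_turn opprB addrC subrK.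
apply: (@heis_map_rotation _ (fun y => - (y ** x)) _ (half_turn x)) => //.
- by move=> a u v; exact: (conic_mull hK).
- move=> a u v; rewrite /half_turn (kipDr hK) (kipZr hK).
  rewrite mulrDr scalerDl scalerBr opprD addrACA; congr (_ - _ + _).
  by rewrite scalerA mulrCA.
- by move=> y /=; rewrite xx opprK.
- by move=> y /=; rewrite (kmulNl hK) xx opprK.
- by move=> y; rewrite hM x1 mulr1.
- move=> v hv; rewrite {1}/half_turn (kipDl hK) (kipZl hK) (kipNl hK) tx.
  rewrite /half_turn (kipDr hK) (kipZr hK) (kipNr hK) (kipC hK v x); ring.
- move=> y y'; apply: (imag_inj hK); rewrite ?ti ?imvalP// => v hv.
  rewrite (kip_impart hK)// (kip_conj_mulr hK hM)// /half_turn.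
  rewrite (kipDl hK) (kipZl hK) (kipNl hK) (kip_impart hK)//.
  by rewrite (kipC hK x (impart _)) (kip_impart hK)// x1 mul1r; ring.
Qed.

Lemma rotation_assoc u : kassoc K -> kip u u = 1 ->
  rotation (heis_map (fun y => y ** u) (fun v => kconj u ** v ** u)).
Proof.
move=> hA u1.
have u1' : kconj u ** u = kone by rewrite (kconj_mul hK) u1 scale1r.
have u1V : u ** kconj u = kone by rewrite (kmul_conj hK) u1 scale1r.
have ti (w v : K) : v \in @imag R K -> kconj w ** v ** w \in @imag R K.
  move=> hv; rewrite inE !(conic_conjM hK) kconjK (imag_conj hv) (kmulNl hK).
  by rewrite (kmulNr hK) opprK hA.
apply: (@heis_map_rotation _ (fun y => y ** kconj u) _
          (fun v => u ** v ** kconj u)).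
- by move=> a x y; exact: (conic_mull hK).
- by move=> a x y; rewrite (conic_mulr hK) (conic_mull hK).
- by move=> y /=; rewrite -hA u1V (conic_mul1 hK).
- by move=> y /=; rewrite -hA u1' (conic_mul1 hK).
- exact: ti.
- by move=> v /(ti (kconj u)); rewrite kconjK.
- by move=> v _; rewrite -!hA u1V (conic_mul1 hK) !hA u1V (conic_1mul hK).
- by move=> v _; rewrite -!hA u1' (conic_mul1 hK) !hA u1' (conic_1mul hK).
- by move=> x; rewrite hM u1 mulr1.
- by move=> v _; rewrite !hM (kip_conj hK) u1 mul1r mulr1.
- move=> x y; rewrite !impartE (kmulZr hK) (kmulZl hK) (kmulDr hK) (kmulDl hK).
  rewrite (kmulNr hK) (kmulNl hK); congr (_ *: (_ - _)).
    by rewrite (conic_conjM hK) !hA.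
  by rewrite !(conic_conjM hK) !kconjK !hA.
Qed.

(** For [p = (z, v)] on the unit sphere of the gauge, [(z ** u, v)] is the image
    of [p] under a rotation, where [u = vnorm2 z + v]. *)
Lemma rotation_exists p :
  kassoc K \/ m = 1%N /\ (forall v, exists x,
    [/\ x \in @imag R K, kip x x = 1 & kip x v = 0]) ->
  gauge4 p = 1 ->
  exists2 f, rotation f &
    f p = (map_mx (fun y => y ** (vnorm2 p.1 *: kone + (p.2 : K))) p.1, p.2).
Proof.
case: p => z v hyp; rewrite /gauge4 (knorm_sqr hK) /=.
set a := vnorm2 z => av; set u := a *: kone + _.
have hv := imvalP v.
case: hyp => [hA|[m1 hx]].
  have u1 : kip u u = 1.
    rewrite /u (kipxD hK) (kipxZ hK) (kipZl hK) (kipC hK kone v) !(kip1r hK).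
    by rewrite (imag_re hK hv) (conic_re1 hK); lra.
  have uE : kconj u = a *: kone - (v : K).
    by rewrite /u kconjD kconjZ (kconj1 hK) (imag_conj hv).
  have vu : (v : K) ** u = u ** (v : K).
    rewrite /u (kmulDr hK) (kmulDl hK) (kmulZr hK) (kmulZl hK).
    by rewrite (conic_1mul hK) (conic_mul1 hK).
  exists (heis_map (fun y => y ** u) (fun v => kconj u ** v ** u)).
    exact: rotation_assoc.
  congr pair; apply: impart_eq; rewrite -hA vu hA (kconj_mul hK) u1 scale1r.
  exact: (conic_1mul hK).
have [x [xi x1 xv]] := hx v.
have refl y : kip y v = 0 -> half_turn y v = - (v : K).
  by move=> yv; rewrite /half_turn yv mulr0 scale0r sub0r.
(* The two half-turns send [v] to [- v] and back. *)
have im2 y : y \in @imag R K -> kip y v = 0 ->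
  impart (half_turn y (impart (half_turn x v))) = v.
  move=> yi yv; apply: impart_eq; rewrite (refl x xv).
  rewrite impart_id ?rpredN// /half_turn (kipNr hK) yv oppr0 mulr0.
  by rewrite scale0r sub0r opprK.
have i0 : 'I_m by rewrite m1; exact: ord0.
have lt1 (j : 'I_m) : (j < 1)%N by rewrite -m1.
have iE (i : 'I_m) : i = i0.
  apply: ord_inj; move: (lt1 i) (lt1 i0).
  by rewrite !ltnS !leqn0 => /eqP-> /eqP->.
have [z0|z0] := eqVneq (z ord0 i0) 0.
  exists (heis_map (fun y => y ** x) (half_turn x) \o
          heis_map (fun y => y ** x) (half_turn x)).
    by apply: rotation_comp; exact: rotation_imag.
  rewrite /= /heis_map /=; congr pair; last exact: im2.
  by apply/rowP => i; rewrite !mxE (iE i) z0 !(kmul0l hK).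
have [y [yi y1 yv yu]] := kmul_two_imag hK hM xi hv x1 xv av z0.
exists (heis_map (fun b : K => b ** y) (half_turn y) \o
        heis_map (fun b : K => b ** x) (half_turn x)).
  by apply: rotation_comp; exact: rotation_imag.
rewrite /= /heis_map /=; congr pair; last exact: im2.
by apply/rowP => i; rewrite !mxE (iE i) yu.
Qed.

End Rotations.

(** * Multiplicative functions on the positive reals *)

Lemma additive_linear (R : realType) (f : R -> R) :
  {morph f : s t / s + t} -> (forall t, 0 < t -> 0 < f t) ->
  forall t, f t = t * f 1.
Proof.
move=> fD fpos.
have f0 : f 0 = 0 by apply: (addrI (f 0)); rewrite -fD !addr0.
have fN t : f (- t) = - f t by apply/eqP; rewrite -addr_eq0 -fD addNr f0.
have fn n t : f (n%:R * t) = n%:R * f t.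
  elim: n => [|n IH]; first by rewrite !mul0r.
  by rewrite -natr1 !mulrDl !mul1r fD IH.
have fle s t : s <= t -> f s <= f t.
  rewrite le_eqVlt => /predU1P[->//|st]; rewrite -(subrK s t) fD lerDr ltW//.
  by rewrite fpos// subr_gt0.
have f1 : 0 < f 1 by exact: fpos.
suff pos t : 0 <= t -> f t = t * f 1.
  move=> t; have [/pos//|t0] := leP 0 t.
  by rewrite -[t]opprK fN pos ?mulNr// oppr_ge0 ltW.
move=> t0; apply/eqP; rewrite -subr_eq0 -normr_eq0; apply/negPn/negP => x0.
set x := `|_| in x0; have {}x0 : 0 < x by rewrite lt_neqAle eq_sym x0 normr_ge0.
pose n := (Num.truncn (f 1 / x)).+1.
have nx : f 1 < n%:R * x by rewrite -ltr_pdivrMr// truncnS_gt.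
have nt0 : 0 <= n%:R * t by rewrite mulr_ge0.
have /andP[lo hi] := truncn_itv nt0.
have := fle _ _ lo; have := fle _ _ (ltW hi).
rewrite -[_.+1%:R]mulr1 -[(Num.truncn _)%:R]mulr1 !fn.
set M := Num.truncn _; rewrite -natr1 => hi' lo'.
have : n%:R * x <= f 1; last by rewrite leNgt nx.
rewrite /x -[n%:R]ger0_norm// -normrM ler_norml.
move: lo hi; rewrite -/M -natr1 => lo hi.
have lo2 : M%:R * f 1 <= n%:R * t * f 1 by rewrite ler_pM2r.
have hi2 : n%:R * t * f 1 <= (M%:R + 1) * f 1 by rewrite ler_pM2r// ltW.
apply/andP; split; lra.
Qed.

Lemma multiplicative_powR (R : realType) (k : R -> R) :
  (forall r, 0 < r -> 0 < k r) ->
  (forall r s, 0 < r -> 0 < s -> k (r * s) = k r * k s) ->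
  (forall r, 0 < r < 1 -> k r < 1) ->
  exists2 a : R, 0 < a & forall r, 0 < r -> k r = r `^ a.
Proof.
move=> k0 kM k1.
(* The two signs make [f] positive on positive reals. *)
pose f t := - ln (k (expR (- t))).
have fD : {morph f : s t / s + t}.
  move=> s t; rewrite /f opprD expRD kM ?expR_gt0// lnM ?posrE ?k0 ?expR_gt0//.
  by rewrite opprD.
have fpos t : 0 < t -> 0 < f t.
  move=> t0; rewrite /f oppr_gt0 ln_lt0// k0 ?expR_gt0//= k1// expR_gt0/=.
  by rewrite -expR0 ltr_expR oppr_lt0.
exists (f 1) => [|r r0]; first exact: fpos.
have := additive_linear fD fpos (- ln r); rewrite {1}/f opprK lnK ?posrE//.
rewrite mulNr => /oppr_inj h.
by rewrite /powR gt_eqF// mulrC -h lnK// posrE k0.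
Qed.

(** * Metrics invariant under the similarities *)

Section Invariance.
Context (R : realType) (K : starAlg R) (m : nat).
Context (hK : conic K) (hM : normed_mul K).
Context (d : heis K m -> heis K m -> R) (hd : is_metric d).
Context (hSim : similarity origin (@dheis R K m) `<=` similarity origin d).
Implicit Types (p q g : heis K m) (r : R).

Local Notation N p := (d origin p).

Lemma dmet_sym p q : d p q = d q p.
Proof. by case: hd. Qed.

Lemma dmet_gt0 p q : p != q -> 0 < d p q.
Proof.
case: hd => d0 ds _ _ pq; rewrite lt_neqAle d0 andbT eq_sym.
by apply: contra pq => /eqP/ds ->.
Qed.

Lemma dmet_tri p q g : d p g <= d p q + d q g.
Proof. by case: hd. Qed.

Lemma dmet_refl p : d p p = 0.
Proof. by case: hd => _ h _ _; apply/h. Qed.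

(** A bijection that scales the Koranyi distance scales [d], possibly by another
    factor. *)
Lemma heis_dilation_scale (f g : heis K m -> heis K m) r : 0 < r ->
  (forall p q, dheis (f p) (f q) = r * dheis p q) -> cancel f g -> cancel g f ->
  exists2 k : R, 0 < k & forall p q, d (f p) (f q) = k * d p q.
Proof.
move=> r0 fr fK gK; apply: (similarity_scale (o := origin)).
by apply: hSim; exact: dilation_similarity fr fK gK (dheis_proper hK hM).
Qed.

Lemma heis_dilK r : r != 0 -> cancel (@heis_dil R K m r) (heis_dil r^-1).
Proof. by move=> r0 p; rewrite heis_dil_comp mulVf// heis_dil1. Qed.

Lemma heis_dilVK r : r != 0 -> cancel (@heis_dil R K m r^-1) (heis_dil r).
Proof. by move=> r0 p; rewrite heis_dil_comp mulfV// heis_dil1. Qed.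

Lemma dil_scale r : 0 < r -> exists2 k : R, 0 < k &
  forall p q, d (heis_dil r p) (heis_dil r q) = k * d p q.
Proof.
move=> r0; apply: (@heis_dilation_scale _ (heis_dil r^-1) r r0).
- by move=> p q; rewrite (dheis_dil hK)// ltW.
- by apply: heis_dilK; rewrite gt_eqF.
- by apply: heis_dilVK; rewrite gt_eqF.
Qed.

Lemma mul_scale g : exists2 k : R, 0 < k &
  forall p q, d (heis_mul g p) (heis_mul g q) = k * d p q.
Proof.
apply: (@heis_dilation_scale _ (heis_mul (heis_inv g)) 1) => //.
- by move=> p q; rewrite (dheis_mull hK)// mul1r.
- exact: heis_mulK.
- exact: heis_mulVK.
Qed.

(** Translations by [g] and by a dilate of [g] are conjugate under a dilation,
    hence have the same scale factor. *)
Lemma mul_dil_scale g r k : 0 < r ->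
  (forall p q, d (heis_mul g p) (heis_mul g q) = k * d p q) ->
  forall p q, d (heis_mul (heis_dil r g) p) (heis_mul (heis_dil r g) q) =
              k * d p q.
Proof.
move=> r0 gk p q; have [c c0 dc] := dil_scale r0.
have r1 : r != 0 by rewrite gt_eqF.
rewrite -[p](heis_dilVK r1) -[q](heis_dilVK r1) -!(heis_dilM hK) !dc gk.
by rewrite mulrCA.
Qed.

(** If some power of [g] of exponent at least 2 is the dilate of [g] by 2, then
    translation by [g] is an isometry of [d]. *)
Lemma dmet_mull_iter g n : (0 < n)%N -> g != origin ->
  (forall p, iter n.+1 (heis_mul g) p = heis_mul (heis_dil 2 g) p) ->
  forall p q, d (heis_mul g p) (heis_mul g q) = d p q.
Proof.
move=> n0 g0 hg p q; have [k k0 gk] := mul_scale g; rewrite gk.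
have iterk j x y : d (iter j (heis_mul g) x) (iter j (heis_mul g) y) =
                   k ^+ j * d x y.
  elim: j => [|j IH]; first by rewrite mul1r.
  by rewrite /= gk IH mulrA exprS.
have := iterk n.+1 g origin; rewrite !hg.
rewrite (mul_dil_scale _ gk)// exprSr -mulrA => /esym/eqP.
rewrite -[X in _ == X]mul1r -subr_eq0 -mulrBl mulf_eq0.
rewrite (gt_eqF (mulr_gt0 _ _)) ?dmet_gt0//.
by rewrite orbF subr_eq0 pexpr_eq1 ?ltW// => /eqP ->; rewrite mul1r.
Qed.

(** The metric [d] is left invariant, as horizontal and vertical elements
    generate the group. *)
Lemma dmet_mull g p q : d (heis_mul g p) (heis_mul g q) = d p q.
Proof.
have horiz z x y : d (heis_mul (z, 0) x) (heis_mul (z, 0) y) = d x y.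
  have [->|z0] := eqVneq (z, 0) (origin : heis K m).
    by rewrite !heis_0mul.
  apply: (dmet_mull_iter (n := 1)) => // t /=.
  rewrite heis_mulA//; congr heis_mul.
  rewrite /heis_mul /heis_dil /= omega_diag// !scaler0 !addr0; congr pair.
  by apply/rowP => i; rewrite !mxE -[_ *: _]/(2%:R *: _) scaler_nat mulr2n.
have vert v x y : d (heis_mul (0, v) x) (heis_mul (0, v) y) = d x y.
  have [->|v0] := eqVneq (0, v) (origin : heis K m).
    by rewrite !heis_0mul.
  apply: (dmet_mull_iter (n := 3)) => // t /=.
  rewrite !heis_mulA//; congr heis_mul.
  rewrite /heis_mul /heis_dil /= !addr0 !omega0l// !scaler0 !addr0; congr pair.
    by apply/rowP => i; rewrite !mxE scaler0.
  by rewrite -natrX scaler_nat !mulrSr mulr0n add0r.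
have -> : g = heis_mul (g.1, 0) (0, g.2).
  by case: g => z v; rewrite /heis_mul /= omega0r// scaler0 !addr0 add0r.
by rewrite -!heis_mulA// horiz vert.
Qed.

Lemma dmet_gauge p q : d p q = N (heis_mul (heis_inv q) p).
Proof. by rewrite -(dmet_mull (heis_inv q)) heis_mulVp// dmet_sym. Qed.

Lemma dmet_inv p : N (heis_inv p) = N p.
Proof. by rewrite [RHS]dmet_gauge heis_mul0. Qed.

Section Topology.
Context (hTop : forall u : nat -> option (heis K m),
  dconverges origin (@dheis R K m) u -> dconverges origin d u).

(** The sequence is interleaved with the origin so that its limit for the
    topology of [d], whose existence alone is assumed, must be the origin. *)
Lemma dil_cvg r p : 0 < r < 1 -> dconverges origin (@dheis R K m)
  (fun n => if odd n then Some origin else Some (heis_dil (r ^+ n) p)).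
Proof.
move=> /andP[r0 r1]; exists (Some origin) => U.
rewrite nbhsE => -[B [[B1 _] Bo] BU].
have [e e0 he] := B1 _ Bo.
have : (fun n => r ^+ n * gauge p) @ \oo --> (0 : R).
  rewrite -[X in _ --> X](mul0r (gauge p)); apply: cvgMl.
  by apply: cvg_expr; rewrite ger0_norm// ltW.
move=> /cvgrPdist_lt /(_ e e0) [M _ hM']; exists M => // n /hM' /= hn.
apply: BU; case: (odd n); first exact: Bo.
apply: he; rewrite (dheis_originl hK) (gauge_dil hK) ?exprn_ge0 ?ltW//.
by apply: le_lt_trans hn; rewrite sub0r normrN ler_norm.
Qed.

Lemma dball_open e : open ([set x : dspace origin d |
  if x is Some p then d origin p < e else False]).
Proof.
split=> [p pe|//]; exists (e - d origin p); first by rewrite subr_gt0.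
by move=> q pq /=; have := dmet_tri origin p q; lra.
Qed.

Lemma dil_small r p : 0 < r < 1 -> p != origin ->
  exists n, N (heis_dil (r ^+ n) p) < N p.
Proof.
move=> r01 p0; have [l ul] := hTop (dil_cvg p r01).
have np : 0 < N p by rewrite dmet_gt0// eq_sym.
have lo : l = Some origin.
  apply: contrapT => l0.
  have oA : open ([set x : dspace origin d | x <> Some origin]).
    split=> [q q0|_].
      exists (d q origin) => [|x xq /= [xo]].
        by apply: dmet_gt0; apply/eqP => h; apply: q0; rewrite h.
      by rewrite xo ltxx in xq.
    by exists 1 => // x xq /= [xo]; move: xq; rewrite xo dmet_refl ltr10.
  have [M _ hM'] := ul _ (open_nbhs_nbhs (conj oA l0)).
  have := hM' (M.*2.+1); rewrite /= odd_double /=; apply => //.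
  by rewrite -addnn -addnS leq_addr.
rewrite lo in ul.
have oN : (Some origin : dspace origin d) \in
   [set x : dspace origin d | if x is Some q then d origin q < N p else False].
  by rewrite inE /= dmet_refl.
rewrite inE in oN.
have [M _ hM'] := ul _ (open_nbhs_nbhs (conj (dball_open (N p)) oN)).
exists M.*2; have := hM' M.*2; rewrite /= odd_double /=; apply.
by rewrite -addnn leq_addr.
Qed.

Lemma dil_powR p0 : p0 != origin -> exists2 a : R, 0 < a &
  forall r p, 0 < r -> N (heis_dil r p) = r `^ a * N p.
Proof.
move=> p00; have np : 0 < N p0 by rewrite dmet_gt0// eq_sym.
pose k r := N (heis_dil r p0) / N p0.
have kE r p : 0 < r -> N (heis_dil r p) = k r * N p.
  move=> r0; have [c c0 hc] := dil_scale r0.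
  have h x : N (heis_dil r x) = c * N x by rewrite -hc heis_dil_origin.
  by rewrite /k !h mulfK// gt_eqF.
have kpos r : 0 < r -> 0 < k r.
  move=> r0; rewrite divr_gt0// dmet_gt0//; apply: contra p00 => /eqP h.
  have r1 : r != 0 by rewrite gt_eqF.
  by rewrite -(heis_dilK r1 p0) -h heis_dil_origin.
have kM r s : 0 < r -> 0 < s -> k (r * s) = k r * k s.
  by move=> r0 s0; rewrite {1}/k -heis_dil_comp kE// -mulrA.
have [|a a0 ka] := multiplicative_powR kpos kM; last first.
  by exists a => // r p r0; rewrite kE// ka.
move=> r r01; have /andP[r0 r1] := r01; rewrite ltNge; apply/negP => kr.
have [n] := dil_small r01 p00; rewrite kE ?exprn_gt0// ltNge => /negP; apply.
rewrite (ler_peMl (ltW np))//.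
have -> : k (r ^+ n) = k r ^+ n; last exact: exprn_ege1.
elim: n => [|n IH]; last by rewrite !exprS kM ?exprn_gt0// IH.
by rewrite !expr0 /k heis_dil1 divff// gt_eqF.
Qed.

End Topology.

Section Inversion.
Context (hInv : moebius origin d (@inversion R K m)).

(** The invariance of the cross-ratio of infinity, the origin, [p] and [q]. *)
Lemma inversion_mul p q p' q' : p != origin -> q != origin ->
  inversion (Some p) = Some p' -> inversion (Some q) = Some q' ->
  N p * N p' = N q * N q'.
Proof.
move=> p0 q0 hp hq; have [[g [fK _ _ _]] hX] := hInv.
have [pq|pq] := eqVneq p q.
  by move: hp hq; rewrite pq => -> [->].
have nz (x x' : heis K m) :
  x != origin -> inversion (Some x) = Some x' -> x' != origin.
  move=> x0 hx; apply: contraTneq isT => x'0.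
  by have := fK (Some x); rewrite hx x'0 -[Some origin]/(inversion None) fK.
have p'0 : 0 < N p' by rewrite dmet_gt0// eq_sym (nz _ _ p0 hp).
have q'0 : 0 < N q' by rewrite dmet_gt0// eq_sym (nz _ _ q0 hq).
have np0 : 0 < N p by rewrite dmet_gt0// eq_sym.
have u : uniq [:: None; Some origin; Some p; Some q].
  have e (x y : heis K m) : (Some x == Some y) = (x == y) by [].
  by rewrite /= !inE !e negb_or ![origin == _]eq_sym p0 q0 pq.
have io : inversion (Some origin) = None :> option (heis K m).
  by rewrite /inversion eqxx.
have := hX _ _ _ _ u; rewrite hp hq io /cross_ratio /=.
rewrite ![d _ origin]dmet_sym !divr1 !mul1r.
move=> /(congr1 (fun x => x * (N p * N q'))) /=.
have -> : (N q')^-1 * N p' * (N p * N q') = N p * N p'.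
  by field; rewrite gt_eqF.
have -> // : N q / N p * (N p * N q') = N q * N q'.
by field; rewrite gt_eqF.
Qed.

(** On the unit sphere of the gauge, the inversion is, up to the group inverse,
    right multiplication of the horizontal part by a unit element. *)
Lemma inversion_unit p : gauge4 p = 1 -> inversion (Some p) = Some (heis_inv
  (map_mx (fun y => y ** (vnorm2 p.1 *: kone + (p.2 : K))) p.1, p.2)).
Proof.
case: p => z v p1; have hv := imvalP v.
have p0 : ((z, v) == origin :> heis K m) = false.
  apply/eqP => h; have := gauge_expr4 ((z, v) : heis K m).
  rewrite p1 h (gauge_origin m hK) expr0n /= => /eqP.
  by rewrite eq_sym oner_eq0.
rewrite /inversion p0; set a := vnorm2 _.
set w : K := - _ + _.
have w1 : knorm w ^+ 2 = 1.
  rewrite (knorm_sqr hK) /w (kipxD hK) (kipxN hK) (kipxZ hK) (kipNl hK).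
  rewrite (kipZl hK) (kipC hK kone v) !(kip1r hK) (imag_re hK hv).
  rewrite (conic_re1 hK); move: p1.
  by rewrite /gauge4 (knorm_sqr hK) /= -/a => p1; lra.
have wE : kconj w = - (a *: kone + (v : K)).
  by rewrite /w kconjD kconjN kconjZ (kconj1 hK) (imag_conj hv) opprD.
congr Some; rewrite /heis_inv w1 invr1 scale1r /kinv w1 invr1 scale1r wE /=.
congr pair; last by apply: val_inj; rewrite /= (imag_conj hv).
by apply/rowP => i; rewrite !mxE (kmulNr hK).
Qed.

(** The two cases in which the rotations needed below are available. *)
Context (hRot : kassoc K \/ m = 1%N /\ (forall v, exists x,
    [/\ x \in @imag R K, kip x x = 1 & kip x v = 0])).

Lemma gauge1_neq0 p : gauge4 p = 1 -> p != origin.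
Proof.
move=> p1; apply: contra_eqN p1 => /eqP ->.
by rewrite -gauge_expr4 (gauge_origin m hK) expr0n eq_sym oner_eq0.
Qed.

(** The metric [d] is constant on the unit sphere centred at the origin. The
    horizontal point [e0] also shows that rotations scale [d] by the factor 1,
    since inversion acts on horizontal unit points as the group inverse. *)
Lemma dmet_unit p e0 : gauge4 p = 1 -> gauge4 e0 = 1 -> e0.2 = 0 ->
  N p = N e0.
Proof.
move=> p1 e1 e2.
have horiz (e : heis K m) : gauge4 e = 1 -> e.2 = 0 ->
  inversion (Some e) = Some (heis_inv e).
  move=> g1 g2; rewrite inversion_unit//; congr (Some (heis_inv _)).
  case: e g1 g2 => z v /= + v0; rewrite /gauge4 v0 /= (knorm_sqr hK).
  rewrite (kip0l hK) addr0 => /eqP; rewrite pexpr_eq1 ?vnorm2_ge0// => /eqP ->.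
  congr pair; apply/rowP => i.
  by rewrite !mxE scale1r [_ + _]addr0 (conic_mul1 hK).
have [f rf fp] := rotation_exists hK hM hRot p1.
have [[g fK gK] fd f0 f2] := rf.
have [k k0 fk] : exists2 k : R, 0 < k & forall x y, d (f x) (f y) = k * d x y.
  by apply: (@heis_dilation_scale f g 1) => // x y; rewrite fd mul1r.
have fN (x : heis K m) : N (f x) = k * N x by rewrite -fk f0.
have fe1 : gauge4 (f e0) = 1.
  rewrite -gauge_expr4 -(dheis_origin hK) -f0 fd (dheis_origin hK).
  by rewrite gauge_expr4.
have sq (x y : R) : 0 < x -> 0 < y -> x * x = y * y -> x = y.
  move=> x0 y0 /eqP; rewrite -!expr2 eqrXn2// ?ltW//.
  by move=> /eqP.
have Npos (e : heis K m) : gauge4 e = 1 -> 0 < N e.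
  by move=> /gauge1_neq0 h; rewrite dmet_gt0// eq_sym.
have k1 : k = 1.
  have := inversion_mul (gauge1_neq0 fe1) (gauge1_neq0 e1)
    (horiz _ fe1 (f2 _ e2)) (horiz _ e1 e2).
  rewrite !dmet_inv => /(sq _ _ (Npos _ fe1) (Npos _ e1)).
  rewrite fN -[RHS]mul1r => /mulIf; apply.
  by rewrite gt_eqF ?Npos.
apply: sq; rewrite ?Npos//.
have := inversion_mul (gauge1_neq0 p1) (gauge1_neq0 e1)
  (inversion_unit p1) (horiz _ e1 e2).
by rewrite -fp !dmet_inv fN k1 mul1r.
Qed.

Context (hTop : forall u : nat -> option (heis K m),
  dconverges origin (@dheis R K m) u -> dconverges origin d u).

(** The metric [d] is a positive multiple of a power of the Koranyi metric. *)
Lemma snowflake : (0 < m)%N -> exists2 b : R, 0 < b &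
  exists2 a : R, 0 < a <= 1 & forall p q, d p q = b * dheis p q `^ a.
Proof.
move=> m0.
have [p0 p00 p02] : exists2 p0 : heis K m, p0 != origin & p0.2 = 0.
  exists (const_mx kone, 0) => //; apply/eqP => -[/rowP/(_ (Ordinal m0))].
  rewrite !mxE => /(congr1 kre); rewrite (conic_re1 hK) (kre0 hK) => /eqP.
  by rewrite oner_eq0.
have gpos p : p != origin -> 0 < gauge p by exact: gauge_gt0.
pose unit p := heis_dil (gauge p)^-1 p : heis K m.
have unit1 p : p != origin -> gauge4 (unit p) = 1.
  move=> /gpos g0; rewrite -gauge_expr4 (gauge_dil hK) ?invr_ge0 ?ltW//.
  by rewrite mulVf ?gt_eqF// expr1n.
pose e0 := unit p0.
have e02 : e0.2 = 0 by rewrite /e0 /unit /heis_dil /= p02 scaler0.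
have e01 : gauge4 e0 = 1 by exact: unit1.
have b0 : 0 < N e0 by rewrite dmet_gt0// eq_sym gauge1_neq0.
clearbody e0.
have [a a0 dilE] := dil_powR hTop p00.
have NE p : N p = N e0 * gauge p `^ a.
  have [->|pn0] := eqVneq p origin.
    by rewrite dmet_refl (gauge_origin m hK) powR0 ?mulr0// gt_eqF.
  have g0 := gpos _ pn0.
  rewrite -(dmet_unit (unit1 _ pn0) e01 e02) mulrC -dilE//.
  by rewrite heis_dilVK// gt_eqF.
exists (N e0) => //; exists a => [|p q]; last by rewrite dmet_gauge NE.
(* As [e0] is horizontal, [e0] and [heis_dil 2 e0] differ by [e0]. *)
rewrite a0 /=.
have := dmet_tri origin e0 (heis_dil 2 e0).
rewrite dilE// [d e0 _]dmet_gauge.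
have -> : heis_mul (heis_inv (heis_dil 2 e0)) e0 = heis_inv e0.
  rewrite /heis_mul /heis_inv /heis_dil e02 /= (omegaNl hK) (omegaZl hK).
  rewrite (omega_diag hK) !scaler0 !oppr0 scaler0 !addr0; congr pair.
  apply/rowP => i; rewrite !mxE scalerDl !scale1r opprD -addrA.
  by rewrite addNr addr0.
rewrite dmet_inv -mulr2n -[N e0 *+ 2]mulr_natl ler_pM2r//.
move=> h; have : ln (2 `^ a) <= ln 2 :> R by rewrite ler_ln ?posrE ?powR_gt0.
rewrite ln_powR => {}h.
by rewrite -(ler_pM2r (ln_gt0 (ltr1n R 2))) mul1r.
Qed.

End Inversion.
End Invariance.

Theorem theorem1p2 (R : realType) (k : hurwitz_name) (n : nat)
  (hn : (2 <= n)%N) (hO : k = Octonions -> n = 2%N) (hR : k <> Reals)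
  (d : heis (hurwitz R k) n.-1 -> heis (hurwitz R k) n.-1 -> R)
  (hd : is_metric d)
  (hSim : similarity origin (@dheis R (hurwitz R k) n.-1)
            `<=` similarity origin d)
  (hTop : forall u : nat -> option (heis (hurwitz R k) n.-1),
     dconverges origin (@dheis R (hurwitz R k) n.-1) u ->
     dconverges origin d u)
  (hInv : moebius origin d (@inversion R (hurwitz R k) n.-1)) :
  exists2 beta : R, 0 < beta &
    exists2 alpha : R, 0 < alpha <= 1 &
      forall p q : heis (hurwitz R k) n.-1, d p q = beta * dheis p q `^ alpha.
Proof.
have hRot : kassoc (hurwitz R k) \/ n.-1 = 1%N /\ (forall v, exists x,
    [/\ x \in @imag R (hurwitz R k), kip x x = 1 & kip x v = 0]).
  have [kO|kO] := pselect (k = Octonions); [right | left].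
    by rewrite hO//; split=> // v; subst k; exact: octonion_orthogonal.
  exact: hurwitz_assoc.
have n1 : (0 < n.-1)%N by case: n hn {d hd hSim hTop hInv hO hRot} => [|[|]].
exact: (snowflake (@hurwitz_conic R k hR) (@hurwitz_normed R k hR)
  hd hSim hInv hRot hTop n1).
Qed.
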